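(* Let $\alpha=1$, let $\nu>0$ be a constant, and let $G$ be chosen according to $\mathrm{Poi}_{1,\nu}(n)$. There exists $\gamma$ with $0<\gamma<1$ such that a.a.s. $L_2(G)=\Omega(n^{\gamma})$ (i.e. for some constant $c_1>0$, a.a.s. $L_2(G)\ge c_1n^\gamma$). Moreover, there exists some $0<\delta<\gamma$ so that for some sufficiently small constant $b>0$, a.a.s. there are $\Omega(n^b)$ connected components in $G$, each one of size $\Omega(n^{\delta})$ (with implied constants not depending on $n$ or on the component).
   Context: The model $\mathrm{Poi}_{\alpha,\nu}(n)$ (Poissonized random hyperbolic graph): let $R:=2\log(n/\nu)$ ($\log$ is the natural logarithm). Let $V$ be the point set of a Poisson point process on the disk of radius $R$ centered at the origin $O$ of the hyperbolic plane (polar coordinates $(r,\theta)$, $0\le r<R$, $0\le\theta<2\pi$), with intensity function $g(r,\theta)=\nu e^{R/2}f(r,\theta)=n f(r,\theta)$ with respect to $dr\,d\theta$, where $f(r,\theta)=\frac{1}{2\pi}f(r)$ and $f(r)=\frac{\alpha\sinh(\alpha r)}{\cosh(\alpha R)-1}$ for $0\le r<R$ (and $0$ otherwise). The vertices of $G$ are the points of $V$; two distinct vertices $u=(r_u,\theta_u)$ and $u'=(r_{u'},\theta_{u'})$ are adjacent iff their hyperbolic distance $\mathrm{d_h}$ is at most $R$, where $\cosh \mathrm{d_h}=\cosh r_u\cosh r_{u'}-\sinh r_u\sinh r_{u'}\cos(\theta_u-\theta_{u'})$. The size of a component is its number of vertices, and $L_2(G)$ is the size of the second largest connected component of $G$.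 An event holds asymptotically almost surely (a.a.s.) if its probability tends to $1$ as $n\to\infty$. *)

(* Defs.v *)
(* MathComp / MathComp-Analysis *)
From HB Require Import structures.
From mathcomp Require Import all_boot all_order all_algebra finmap.
From mathcomp Require Import all_classical all_reals all_analysis.
From mathcomp Require Import ring lra.

Set Implicit Arguments.
Unset Strict Implicit.
Unset Printing Implicit Defensive.

Import Order.TTheory GRing.Theory Num.Theory.
Import numFieldNormedType.Exports.

Local Open Scope classical_set_scope.
Local Open Scope ring_scope.

Section PoissonProcess.
Context {d d' : measure_display} {R : realType}.
Context {Om : measurableType d} {T : measurableType d'}.

Definition npoints (V : Om -> {fset T}) (A : set T) (w : Om) : nat :=
  #|` [fset x in V w | x \in A]%fset|.

(* A Poisson point process with finite intensity measure [mu], realised as a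
   random finite set (the processes considered have diffuse intensity, so there
   are no multiple points).  The second argument of the library's
   [poisson_prob] is a dummy; [poisson_prob 0] is the point mass at 0. *)
Record poisson_process (P : probability Om R) (mu : set T -> \bar R)
    (V : Om -> {fset T}) : Prop := PoissonProcess {
  pp_measurable : forall A, measurable A ->
    measurable_fun [set: Om] (npoints V A);
  pp_poisson : forall A, measurable A -> forall U : set nat,
    P (npoints V A @^-1` U) = poisson_prob (fine (mu A)) 0%N U;
  pp_independent : forall (m : nat) (A : 'I_m -> set T),
    (forall i, measurable (A i)) -> trivIset [set: 'I_m] A ->
    forall U : 'I_m -> set nat,
      P (\bigcap_(i in [set: 'I_m]) (npoints V (A i) @^-1` U i)) =
      (\prod_(i < m) P (npoints V (A i) @^-1` U i))%E }.

End PoissonProcess.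

Section HyperbolicPlane.
Context {R : realType}.
Implicit Types (x : R) (u v : R * R).

Definition cosh x : R := (expR x + expR (- x)) / 2.
Definition sinh x : R := (expR x - expR (- x)) / 2.

(* Points are given by polar coordinates (r, theta). *)
Definition cosh_hdist u v : R :=
  cosh u.1 * cosh v.1 - sinh u.1 * sinh v.1 * cos (u.2 - v.2).

Definition hdist u v : R := xget 0 [set x | 0 <= x /\ cosh x = cosh_hdist u v].

Lemma hdistP u v : 0 <= u.1 -> 0 <= v.1 ->
  0 <= hdist u v /\ cosh (hdist u v) = cosh_hdist u v.
Proof.
move=> u0 v0; set X := cosh_hdist u v.
have sinh_ge0 x : 0 <= x -> 0 <= sinh x.
  move=> x0; rewrite /sinh divr_ge0 // subr_ge0 ler_expR; lra.
have X1 : 1 <= X.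
  have c1 : cos (u.2 - v.2) <= 1 by exact: cos_le1.
  have s0 : 0 <= sinh u.1 * sinh v.1 by rewrite mulr_ge0 ?sinh_ge0.
  have le1 : cosh u.1 * cosh v.1 - sinh u.1 * sinh v.1 <= X.
    by rewrite /X /cosh_hdist lerD2l lerN2 ler_piMr.
  apply: le_trans le1.
  have ne a : expR a != 0 :> R by rewrite gt_eqF ?expR_gt0.
  have -> : cosh u.1 * cosh v.1 - sinh u.1 * sinh v.1 =
      (expR u.1 / expR v.1 + (expR u.1 / expR v.1)^-1) / 2.
    by rewrite /cosh /sinh !expRN; field; rewrite !ne.
  have p0 : 0 < expR u.1 / expR v.1 by rewrite divr_gt0 ?expR_gt0.
  move: p0; set p := expR u.1 / expR v.1 => p0.
  have pp : p * p^-1 = 1 by rewrite divff ?gt_eqF.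
  have q0 : 0 < p^-1 by rewrite invr_gt0.
  have : 0 <= (p - p^-1) ^+ 2 by exact: sqr_ge0.
  nra.
set S := [set x | 0 <= x /\ cosh x = X].
suff : exists x, S x by move=> [x Sx]; exact: (xgetI 0 Sx).
pose s := Num.sqrt (X ^+ 2 - 1).
have s0 : 0 <= s by exact: sqrtr_ge0.
have ss : s ^+ 2 = X ^+ 2 - 1 by rewrite sqr_sqrtr //; nra.
have e0 : 0 < X + s by lra.
exists (ln (X + s)); split; first by rewrite ln_ge0 //; lra.
rewrite /cosh expRN lnK ?posrE //.
have -> : (X + s)^-1 = X - s.
  apply: (mulfI (lt0r_neq0 e0)); rewrite divff ?lt0r_neq0 //.
  have -> : (X + s) * (X - s) = X ^+ 2 - s ^+ 2 by ring.
  by rewrite ss; ring.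
lra.
Qed.

End HyperbolicPlane.

Section HyperbolicGraph.
Context {R : realType}.
Implicit Types (alpha nu rad : R) (n : nat) (V : {fset (R * R)}).

Definition hrg_radius nu n : R := 2 * ln (n%:R / nu).

Definition disk rad : set (R * R) :=
  [set p | 0 <= p.1 < rad /\ 0 <= p.2 < 2 * pi].

Definition radial_density alpha rad (r : R) : R :=
  if 0 <= r < rad then alpha * sinh (alpha * r) / (cosh (alpha * rad) - 1)
  else 0.

Definition intensity alpha nu n (p : R * R) : R :=
  nu * expR (hrg_radius nu n / 2) *
    ((2 * pi)^-1 * radial_density alpha (hrg_radius nu n) p.1).

Definition intensity_measure alpha nu n (A : set (R * R)) : \bar R :=
  (\int[lebesgue_measure \x lebesgue_measure]_(p in A `&` disk (hrg_radius nu n))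
     (intensity alpha nu n p)%:E)%E.

Definition PoissonHRG {d} {Om : measurableType d} (P : probability Om R)
    alpha nu n (V : Om -> {fset (R * R)}) : Prop :=
  (forall w p, p \in V w -> disk (hrg_radius nu n) p) /\
  poisson_process (T := (measurableTypeR R * measurableTypeR R)%type)
    P (intensity_measure alpha nu n) V.

Definition hrg_adj rad V : rel V :=
  fun u v => (u != v) && (hdist (val u) (val v) <= rad).

Definition components rad V : {set {set V}} :=
  equivalence_partition (connect (@hrg_adj rad V)) [set: V].

(* 0 if there are fewer than two components. *)
Definition L2 rad V : nat :=
  nth 0%N (sort geq [seq #|C| | C : {set V} <- enum (components rad V)]) 1%N.

Definition ncomponents_ge rad V (s : R) : nat :=
  #|[set C in components rad V | s <= #|C|%:R]|.

(* Asymptotically almost surely, for the graph on Poi_{alpha,nu}(n):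
   [Q n V] is a property of the graph on the vertex set [V].  The law of [V] is
   all that matters, so the underlying probability spaces are arbitrary.  The
   event is only required to contain measurable events of probability tending
   to 1, so that no claim is made about its own measurability. *)
Definition aas alpha nu (Q : nat -> {fset (R * R)} -> Prop) : Prop :=
  forall (d : nat -> measure_display) (Om : forall n, measurableType (d n))
    (P : forall n, probability (Om n) R) (V : forall n, Om n -> {fset (R * R)}),
    (forall n, PoissonHRG (P n) alpha nu n (V n)) ->
    exists E : forall n, set (Om n),
      [/\ forall n, measurable (E n),
          forall n, E n `<=` [set w | Q n (V n w)] &
          P n (E n) @[n --> \oo] --> 1%E].

End HyperbolicGraph.

(* Main.v *)
(* At alpha = 1 the expected number of points of a given height rad - r that
   obstruct a cut between two angles does not depend on the height.  A sector of
   angle about n^(a - 1) is therefore separated from the rest of the graph with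
   probability at least n^(- C a): it suffices that a "moat", whose expected
   number of points is of order a log n, is empty.  Inside the sector a single
   point (in the "hub") of radius about (1 - a / 2) rad is adjacent to all points
   in a set of "leaves" near the boundary circle, of which there are about n^(a / 2).
   The moats of n^(1/16) evenly spaced sectors are disjoint once the core
   r < rad / 4, a.a.s. empty, is ignored; for a small, grouping the sectors into
   n^(1/32) groups of n^(1/32) sectors, a.a.s. every group contains an isolated
   star, by independence. *)
Require Import Defs.
From HB Require Import structures.
From mathcomp Require Import all_boot all_order all_algebra finmap.
From mathcomp Require Import all_classical all_reals all_analysis.
From mathcomp Require Import measurable_realfun ring lra.

Set Implicit Arguments.
Unset Strict Implicit.
Unset Printing Implicit Defensive.

Import Order.TTheory GRing.Theory Num.Theory.
Import numFieldNormedType.Exports.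

Local Open Scope classical_set_scope.
Local Open Scope ring_scope.

(** * Hyperbolic distances *)

(** Put h = a rad / 4. Up to constants the hub of a sector expects at least e^(-h) points and its
    leaves at least e^h, while its moat expects at most 192 nu h + O(1): below radius rad - 6 h the
    moat carries a bounded mass, so only a layer of depth 6 h counts. A sector thus succeeds with
    probability at least of order e^(-(1 + 192 nu) h), and a is chosen to keep this above
    e^(-rad/128), about n^(-1/64). As a group has about n^(1/32) sectors, it fails with probability
    exponentially small in a power of n, and a union bound over groups suffices. Fixing the groups
    in advance replaces a concentration estimate for the number of stars. Isolation has to be read
    off from fixed disjoint regions, otherwise independence is lost. The moat is therefore so wide
    that no single edge can jump over it, wherever its endpoints are outside the core. Its width
    grows towards the centre, which is why the core must be empty before moats of different sectors
    can be disjoint. The giant component is never studied: two large components already bound [L2]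
    from below. *)

Section Trigonometry.
Context {R : realType}.
Implicit Types x y d : R.

(** Serves both directions: cos c <= 1 yields the lower bound on cos, and that bound, applied to c,
    yields the upper bound near 0. *)
Lemma sin_MVT x : 0 <= x -> exists2 c, 0 <= c <= x & sin x = cos c * x.
Proof.
move=> x0.
have [c cx] := @MVT_segment R sin cos 0 x x0 (fun y _ => is_derive_sin y)
  (continuous_subspaceT (@continuous_sin R)).
by rewrite sin0 !subr0; exists c => //; rewrite (itvP cx).
Qed.

Lemma one_minus_cos x : 1 - cos x = 2 * sin (x / 2) ^+ 2.
Proof.
have -> : cos x = cos ((x / 2) *+ 2) by congr cos; rewrite mulr2n; lra.
by rewrite cos_mulr2n sin2cos2; ring.
Qed.

Lemma cos_lower_bound x : 1 - x ^+ 2 / 2 <= cos x.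
Proof.
suff : 1 - cos x <= x ^+ 2 / 2 by lra.
wlog x0 : x / 0 <= x.
  move=> H; have [/H//|/ltW xN] := leP 0 x.
  by rewrite -cosN -sqrrN; apply: H; lra.
rewrite one_minus_cos.
have [|c _ ->] := @sin_MVT (x / 2); first lra.
have : cos c ^+ 2 <= 1 by rewrite cos2sin2; have := sqr_ge0 (sin c); lra.
rewrite exprMn; move: (cos c ^+ 2) => k k1.
suff : 0 <= (1 - k) * x ^+ 2 by lra.
by rewrite mulr_ge0 ?sqr_ge0 // subr_ge0.
Qed.

(** Differences of polar angles are not reduced modulo 2 pi; the two-sided condition on [|x|] says
    that the angles are at least [d] apart on the circle. Reflecting [|x|] to 2 pi - [|x|] reduces
    to [d, pi], where cos decreases. *)
Lemma one_minus_cos_ge d x : 0 <= d <= 1 -> d <= `|x| <= 2 * pi - d ->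
  d ^+ 2 / 4 <= 1 - cos x.
Proof.
move=> /andP[d0 d1] /andP[dx xd].
have pi2 : 2 <= pi :> R by exact: pi_ge2.
have near0 : d ^+ 2 / 4 <= 1 - cos d.
  rewrite one_minus_cos.
  have [|c /andP[c0 cd] ->] := @sin_MVT (d / 2); first lra.
  have := cos_lower_bound c.
  have : c ^+ 2 <= 1 / 4 by nra.
  move=> H1 H2; have {H1 H2} H : 7 / 8 <= cos c by lra.
  rewrite exprMn; have : 1 / 2 <= cos c ^+ 2 by nra.
  move=> K; suff : 0 <= (cos c ^+ 2 - 1 / 2) * d ^+ 2 by lra.
  by rewrite mulr_ge0 ?sqr_ge0 // subr_ge0.
apply: le_trans near0 _; rewrite lerD2l lerN2 -(cos_norm x).
have le_cos y : d <= y -> y <= pi -> cos y <= cos d.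
  move=> dy ypi; rewrite leNgt; apply/negP.
  by rewrite ltr_cos ?in_itv /=; lra.
have [xpi|xpi] := leP `|x| pi; first exact: le_cos.
have -> : cos `|x| = cos (pi *+ 2 - `|x|).
  by rewrite -cosN -(cosD2pi (- `|x|)) addrC.
by apply: le_cos; rewrite mulr2n; lra.
Qed.

End Trigonometry.

Section HyperbolicDistance.
Context {R : realType}.
Implicit Types (x y r : R) (u v : R * R).

Lemma cosh_le_expR x : 0 <= x -> cosh x <= expR x.
Proof.
move=> x0; rewrite /cosh; have : expR (- x) <= expR x by rewrite ler_expR; lra.
lra.
Qed.

Lemma expR_le_cosh x : expR x / 2 <= cosh x.
Proof. by rewrite /cosh; have := expR_gt0 (- x); lra. Qed.

Lemma cosh_ge1 x : 1 <= cosh x.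
Proof. by rewrite /cosh; have := expR_ge1Dx x; have := expR_ge1Dx (- x); lra. Qed.

Lemma sinh_ge0 x : 0 <= x -> 0 <= sinh x.
Proof.
move=> x0; rewrite /sinh; have : expR (- x) <= expR x by rewrite ler_expR; lra.
lra.
Qed.

Lemma sinh_le_expR x : sinh x <= expR x / 2.
Proof. by rewrite /sinh; have := expR_gt0 (- x); lra. Qed.

Lemma expR_le_sinh x : 1 <= x -> expR x / 4 <= sinh x.
Proof.
move=> x1; rewrite /sinh.
have e1 : 2 <= expR x by have := expR_ge1Dx x; lra.
have e2 : 0 < expR (- x) by exact: expR_gt0.
have e3 : expR x * expR (- x) = 1 by rewrite -expRD subrr expR0.
nra.
Qed.

Lemma ler_cosh x y : 0 <= x -> 0 <= y -> (cosh x <= cosh y) = (x <= y).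
Proof.
have lt_cosh a b : 0 <= a -> a < b -> cosh a < cosh b.
  move=> a0 ab.
  have ea : 1 <= expR a by have := expR_ge1Dx a; lra.
  have lab : expR a < expR b by rewrite ltr_expR.
  have ia : expR a * expR (- a) = 1 by rewrite -expRD subrr expR0.
  have ib : expR b * expR (- b) = 1 by rewrite -expRD subrr expR0.
  have pa : 0 < expR (- a) by exact: expR_gt0.
  have pb : 0 < expR (- b) by exact: expR_gt0.
  have a1 : expR (- a) <= 1 by nra.
  have b1 : expR (- b) < 1 by nra.
  rewrite /cosh ltr_pM2r ?invr_gt0 //.
  have -> : expR a + expR (- a) = expR b + expR (- b) -
    (expR b - expR a) * (1 - expR (- a) * expR (- b)).
    by transitivity (expR b + expR (- b) - (expR b - expR a)
      + ((expR b * expR (- b)) * expR (- a)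
         - (expR a * expR (- a)) * expR (- b))); [rewrite ia ib|]; ring.
  have : 0 < (expR b - expR a) * (1 - expR (- a) * expR (- b)).
    by rewrite mulr_gt0 ?subr_gt0 //; nra.
  lra.
move=> x0 y0; have [xy|yx] := leP x y.
  by move: xy; rewrite le_eqVlt => /predU1P[->|/lt_cosh-/(_ x0)/ltW//]; rewrite lexx.
by apply/negbTE; rewrite -ltNge; exact: lt_cosh.
Qed.

Lemma hdist_le u v r : 0 <= u.1 -> 0 <= v.1 -> 0 <= r ->
  (hdist u v <= r) = (cosh_hdist u v <= cosh r).
Proof.
by move=> u0 v0 r0; have [h0 <-] := hdistP u0 v0; rewrite ler_cosh.
Qed.

(** The definition is a difference of two exponentially large terms. Here it becomes a sum of a
    radial and an angular term, both nonnegative for nonnegative radii, which can be estimated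
    separately. *)
Lemma cosh_hdistE u v : cosh_hdist u v =
  cosh (u.1 - v.1) + sinh u.1 * sinh v.1 * (1 - cos (u.2 - v.2)).
Proof.
by rewrite /cosh_hdist /cosh /sinh opprB !expRD; field.
Qed.

(** The angular term alone reaches e^r: 64 is 16 from the two sinh factors times 4 from
    [one_minus_cos_ge]. The radial term, at least 1, makes the inequality strict. *)
Lemma hdist_gt u v r d : 1 <= u.1 -> 1 <= v.1 -> 0 <= r ->
  0 <= d <= 1 -> d <= `|u.2 - v.2| <= 2 * pi - d ->
  64 * expR r <= expR (u.1 + v.1) * d ^+ 2 ->
  r < hdist u v.
Proof.
move=> u1 v1 r0 d01 dd big.
rewrite ltNge hdist_le //; try lra.
rewrite -ltNge cosh_hdistE.
have := cosh_le_expR r0; have := cosh_ge1 (u.1 - v.1).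
have c := one_minus_cos_ge d01 dd.
have su := expR_le_sinh u1; have sv := expR_le_sinh v1.
have s : expR (u.1 + v.1) / 16 <= sinh u.1 * sinh v.1.
  rewrite expRD; have -> : expR u.1 * expR v.1 / 16 = (expR u.1 / 4) * (expR v.1 / 4) by field.
  by apply: ler_pM => //; rewrite divr_ge0 // expR_ge0.
have : expR (u.1 + v.1) / 16 * (d ^+ 2 / 4) <= sinh u.1 * sinh v.1 * (1 - cos (u.2 - v.2)).
  by apply: ler_pM => //; rewrite divr_ge0 ?expR_ge0 ?sqr_ge0.
lra.
Qed.

(** The two hypotheses bound the radial and the angular term by e^r / 4 each, and cosh r >= e^r /
    2. *)
Lemma hdist_small u v r : 0 <= u.1 <= v.1 -> 0 <= r ->
  4 * expR (v.1 - u.1) <= expR r ->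
  expR (u.1 + v.1) * (u.2 - v.2) ^+ 2 <= 2 * expR r ->
  hdist u v <= r.
Proof.
move=> /andP[u0 uv] r0 h1 h2.
have v0 : 0 <= v.1 by lra.
rewrite hdist_le // cosh_hdistE.
have h3 : cosh (u.1 - v.1) <= expR (v.1 - u.1).
  have -> : cosh (u.1 - v.1) = cosh (v.1 - u.1) by rewrite /cosh !opprB (addrC (expR _)).
  by apply: cosh_le_expR; lra.
have h4 := expR_le_cosh r.
have c0 : 1 - cos (u.2 - v.2) <= (u.2 - v.2) ^+ 2 / 2.
  by have := cos_lower_bound (u.2 - v.2); lra.
have c1 : 0 <= 1 - cos (u.2 - v.2) by have := cos_le1 (u.2 - v.2); lra.
have : sinh u.1 * sinh v.1 * (1 - cos (u.2 - v.2)) <=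
   (expR u.1 / 2 * (expR v.1 / 2)) * ((u.2 - v.2) ^+ 2 / 2).
  apply: ler_pM => //; first by rewrite mulr_ge0 ?sinh_ge0.
  by apply: ler_pM; rewrite ?sinh_ge0 ?sinh_le_expR.
by rewrite expRD in h2; lra.
Qed.

End HyperbolicDistance.

(** * Poisson counts and independent events *)

Section PoissonLaw.
Context {R : realType}.
Implicit Types l : R.

Lemma exp_partial_sum l (K : nat) : 0 <= l ->
  \sum_(k < K) l ^+ k / k`!%:R <= expR l.
Proof.
move=> l0.
have := @nondecreasing_cvgn_le R (series (exp_coeff l)) _ (is_cvg_series_exp_coeff l) K.
rewrite -[limn _]/(expR l) /series /= big_mkord; apply.
by apply: nondecreasing_series => n _ _; exact: exp_coeff_ge0.
Qed.

Lemma poisson_prob_eq0 l : 0 <= l ->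
  poisson_prob l 0%N [set 0%N] = (expR (- l))%:E.
Proof.
rewrite le_eqVlt => /predU1P[<-|l0]; rewrite /poisson_prob.
  by rewrite ltxx oppr0 expR0 diracE mem_set.
by rewrite l0 esum_set1 ?lee_fin ?poisson_pmf_ge0 // /poisson_pmf l0 expr0 fact0 invr1 !mul1r.
Qed.

(** Markov's inequality for 2^(-X), whose mean is e^(-l/2), with e^K in place of 2^K. It is crude
    but effective once K <= l / 4. *)
Lemma poisson_prob_lt l (K : nat) : 0 <= l ->
  (poisson_prob l 0%N [set k | (k < K)%N] <= (expR (K%:R - l / 2))%:E)%E.
Proof.
rewrite le_eqVlt => /predU1P[<-|l0]; rewrite /poisson_prob.
  rewrite ltxx diracE mul0r subr0 lee_fin.
  have : 1 <= expR (K%:R : R) by rewrite -expR0 ler_expR.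
  by apply: le_trans; case: (_ \in _).
rewrite l0 esum_fset; last 2 first.
- exact: finite_II.
- by move=> k _; rewrite lee_fin poisson_pmf_ge0.
rewrite -fsbig_ord sumEFin lee_fin.
apply: (@le_trans _ _ (expR K%:R * expR (- l) * \sum_(k < K) (l / 2) ^+ k / k`!%:R)).
  (* l^k = 2^k (l/2)^k and 2^k <= e^K *)
  rewrite mulr_sumr; apply: ler_sum => k _; rewrite /poisson_pmf l0.
  have -> : l ^+ k / k`!%:R * expR (- l) = 2 ^+ k * expR (- l) * ((l / 2) ^+ k / k`!%:R).
    rewrite {1}(_ : l = 2 * (l / 2)); last lra.
    by rewrite exprMn; ring.
  rewrite ler_wpM2r ?divr_ge0 ?exprn_ge0 ?divr_ge0 //; try exact: ltW.
  rewrite ler_wpM2r ?expR_ge0 //.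
  apply: (@le_trans _ _ (expR 1 ^+ k)).
    by rewrite lerXn2r ?nnegrE ?expR_ge0 //; have := expR_ge1Dx (1 : R); lra.
  by rewrite -expRM_natl mulr1 ler_expR ler_nat ltnW.
have -> : K%:R - l / 2 = K%:R + - l + l / 2 :> R by lra.
by rewrite 2!expRD ler_wpM2l ?mulr_ge0 ?expR_ge0 // exp_partial_sum // divr_ge0 // ltW.
Qed.

End PoissonLaw.

Section RealProbability.
Context {d : measure_display} {R : realType} {Om : measurableType d}.
Variable P : probability Om R.
Implicit Types A B : set Om.

(** Real-valued, so that estimates can be left to linear arithmetic. *)
Definition pr A : R := fine (P A).

Lemma prE A : measurable A -> P A = (pr A)%:E.
Proof. by move=> mA; rewrite /pr fineK // fin_num_measure. Qed.

Lemma pr_le1 A : measurable A -> pr A <= 1.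
Proof. by move=> mA; rewrite -lee_fin -prE // probability_le1. Qed.

Lemma pr_setT : pr setT = 1.
Proof. by rewrite /pr probability_setT. Qed.

Lemma pr_setC A : measurable A -> pr (~` A) = 1 - pr A.
Proof.
move=> mA; apply: EFin_inj; rewrite EFinB -!prE //; last exact: measurableC.
exact: probability_setC.
Qed.

Lemma pr_le A B : measurable A -> measurable B -> A `<=` B -> pr A <= pr B.
Proof. by move=> mA mB AB; rewrite -lee_fin -!prE // le_measure ?inE. Qed.

Lemma pr_setU A B : measurable A -> measurable B -> pr (A `|` B) <= pr A + pr B.
Proof.
move=> mA mB; rewrite -lee_fin EFinD -!prE //; last exact: measurableU.
exact: measureU2.
Qed.

Lemma pr_setD A B : measurable A -> measurable B -> B `<=` A ->
  pr (A `\` B) = pr A - pr B.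
Proof.
move=> mA mB BA; apply: EFin_inj; rewrite EFinB -!prE //; last exact: measurableD.
rewrite measureD // ?ltey_eq ?fin_num_measure //.
by rewrite setIidr.
Qed.

Lemma measurable_exists (I : finType) (E : I -> set Om) :
  (forall i, measurable (E i)) -> measurable [set w | exists i, E i w].
Proof.
move=> mE; have -> : [set w | exists i, E i w] = \bigcup_(i in [set: I]) E i.
  by apply/seteqP; split=> w /= [i]; [move=> Ei|move=> _ Ei]; exists i.
by apply: fin_bigcup_measurable => //; exact: finite_finset.
Qed.

Lemma measurable_forall (I : finType) (E : I -> set Om) :
  (forall i, measurable (E i)) -> measurable [set w | forall i, E i w].
Proof.
move=> mE; have -> : [set w | forall i, E i w] = \bigcap_(i in [set: I]) E i.
  by apply/seteqP; split=> w /= Ew i; [move=> _|]; exact: Ew.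
by apply: fin_bigcap_measurable => //; exact: finite_finset.
Qed.

Lemma pr_exists (I : finType) (E : I -> set Om) (q : R) :
  (forall i, measurable (E i)) -> (forall i, pr (E i) <= q) ->
  pr [set w | exists i, E i w] <= #|I|%:R * q.
Proof.
move=> mE Eq.
pose S (s : seq I) := [set w | exists2 i, i \in s & E i w].
have mS s : measurable (S s).
  rewrite (_ : S s = \bigcup_(i in [set` s]) E i).
    by apply: fin_bigcup_measurable => //; exact: finite_seq.
  by apply/seteqP; split=> w /= [i iS Ei]; exists i.
have H s : pr (S s) <= (size s)%:R * q.
  elim: s => [|i s IH].
    rewrite mul0r (_ : S [::] = set0) /pr ?measure0 //.
    by apply/seteqP; split=> w //= [].
  rewrite (_ : S (i :: s) = E i `|` S s); last first.
    apply/seteqP; split=> w /=.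
      by move=> [j]; rewrite inE => /predU1P[->|js] Ej; [left|right; exists j].
    by move=> [Ei|[j js Ej]]; [exists i; rewrite ?mem_head|exists j; rewrite // inE js orbT].
  apply: le_trans (pr_setU _ _) _ => //.
  by rewrite /= -nat1r mulrDl mul1r lerD.
rewrite cardE; apply: le_trans (H (enum I)); apply: pr_le => //.
  exact: measurable_exists.
by move=> w /= [i Ei]; exists i; rewrite ?mem_enum.
Qed.

Section IndependentEvents.
Variables (I : finType) (E : I -> set Om).
Hypothesis mE : forall i, measurable (E i).
Hypothesis indep : forall J : seq I, uniq J ->
  pr [set w | forall i, i \in J -> E i w] = \prod_(i <- J) pr (E i).

(* Excluding one more event i subtracts the probability of the same event with i
   included, hence the two lists. *)
Lemma pr_independent_setC (J K : seq I) : uniq (J ++ K) ->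
  pr [set w | (forall i, i \in J -> E i w) /\ (forall i, i \in K -> ~ E i w)] =
  \prod_(i <- J) pr (E i) * \prod_(i <- K) (1 - pr (E i)).
Proof.
have mS (J' K' : seq I) : measurable
    [set w | (forall i, i \in J' -> E i w) /\ (forall i, i \in K' -> ~ E i w)].
  rewrite (_ : [set w | _] = \bigcap_(i in [set` J']) E i `&` \bigcap_(i in [set` K']) ~` E i).
    apply: measurableI; apply: fin_bigcap_measurable => //;
      try exact: finite_seq.
    by move=> i _; exact: measurableC.
  by apply/seteqP; split=> w /= [a b]; split.
elim: K J => [|k K IH] J uJK.
  rewrite big_nil mulr1 -indep; last by rewrite cats0 in uJK.
  by congr pr; apply/seteqP; split=> w /=; [case|split].
have ukJ : uniq ((k :: J) ++ K) by rewrite (perm_uniq (permEl (perm_catCA [:: k] J K))).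
have uJ : uniq (J ++ K) by move: ukJ => /= /andP[].
have -> : [set w | (forall i, i \in J -> E i w) /\ (forall i, i \in k :: K -> ~ E i w)] =
    [set w | (forall i, i \in J -> E i w) /\ (forall i, i \in K -> ~ E i w)] `\`
    [set w | (forall i, i \in k :: J -> E i w) /\ (forall i, i \in K -> ~ E i w)].
  apply/seteqP; split=> w /=.
    move=> [EJ EK]; split; first by split => // i iK; apply: EK; rewrite inE iK orbT.
    by move=> [/(_ k (mem_head _ _)) Ek _]; apply: (EK k (mem_head _ _)).
  move=> [[EJ EK] nE]; split => // i; rewrite inE => /predU1P[->|/EK//] Ek.
  by apply: nE; split => // j; rewrite inE => /predU1P[->//|/EJ].
rewrite pr_setD // ?IH // ?big_cons; last first.
  by move=> w /= [EJ EK]; split => // i iJ; apply: EJ; rewrite inE iJ orbT.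
by ring.
Qed.

Lemma pr_none_le (K : seq I) (q : R) : uniq K -> q <= 1 ->
  (forall i, q <= pr (E i)) ->
  pr [set w | forall i, i \in K -> ~ E i w] <= (1 - q) ^+ size K.
Proof.
move=> uK q1 qE; have := @pr_independent_setC [::] K uK.
rewrite big_nil mul1r (_ : [set w | _] = [set w | forall i, i \in K -> ~ E i w]); last first.
  by apply/seteqP; split=> w /=; [case|split].
move=> ->; elim: K uK => [|k K IH] /=; first by rewrite big_nil expr0.
move=> /andP[_ /IH le]; rewrite big_cons exprS ler_pM //.
- by rewrite subr_ge0 pr_le1.
- by apply: prodr_ge0 => i _; rewrite subr_ge0 pr_le1.
- by rewrite lerD2l lerN2.
Qed.

End IndependentEvents.

End RealProbability.

Section PoissonProcessEvents.
Context {d d' : measure_display} {R : realType}.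
Context {Om : measurableType d} {T : measurableType d'}.
Variables (P : probability Om R) (mu : set T -> \bar R) (V : Om -> {fset T}).
Hypothesis PV : poisson_process P mu V.

Lemma measurable_npoints (A : set T) (U : set nat) : measurable A ->
  measurable (npoints V A @^-1` U).
Proof. by move=> mA; have := pp_measurable PV mA measurableT (Y := U) I; rewrite setTI. Qed.

Lemma pr_npoints_eq0 (A : set T) : measurable A -> 0 <= fine (mu A) ->
  pr P (npoints V A @^-1` [set 0%N]) = expR (- fine (mu A)).
Proof. by move=> mA l0; rewrite /pr (pp_poisson PV) // poisson_prob_eq0. Qed.

Lemma pr_npoints_lt (A : set T) (K : nat) : measurable A -> 0 <= fine (mu A) ->
  pr P (npoints V A @^-1` [set k | (k < K)%N]) <= expR (K%:R - fine (mu A) / 2).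
Proof.
move=> mA l0; rewrite -lee_fin -prE; last exact: measurable_npoints.
by rewrite (pp_poisson PV) // poisson_prob_lt.
Qed.

(** Enumerating [J] carries the independence axiom from ordinals to arbitrary finite index types,
    such as triples of group, sector and region. *)
Lemma pr_npoints_fin (J : finType) (A : J -> set T) (U : J -> set nat) :
  (forall i, measurable (A i)) -> trivIset [set: J] A ->
  pr P [set w | forall i, U i (npoints V (A i) w)] =
  \prod_i pr P (npoints V (A i) @^-1` U i).
Proof.
move=> mA tA.
pose A' (k : 'I_#|J|) := A (enum_val k).
have tA' : trivIset [set: 'I_#|J|] A'.
  by move=> i j _ _ /tA H; apply: enum_val_inj; exact: H.
have := pp_independent PV (A := A') (fun i => mA _) tA' (fun k => U (enum_val k)).
rewrite (_ : \bigcap_(i in _) _ = [set w | forall i, U i (npoints V (A i) w)]); last first.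
  apply/seteqP; split=> w /= H i; last by move=> _; exact: H.
  by have := H (enum_rank i) I; rewrite /A' /= enum_rankK.
rewrite /pr => ->.
rewrite (eq_bigr (fun k => (pr P (npoints V (A' k) @^-1` U (enum_val k)))%:E)); last first.
  by move=> k _; rewrite prE //; exact: (measurable_npoints _ (mA _)).
by rewrite prodEFin /= (big_enum_val (A := J)).
Qed.

End PoissonProcessEvents.

(** * Components *)

Section SecondLargest.

(** If the second entry of the decreasing list were below [k], so would be all later ones, leaving
    at most one entry to count. *)
Lemma leq_nth1_sort (s : seq nat) (k : nat) :
  (1 < count (leq k) s)%N -> (k <= nth 0%N (sort geq s) 1%N)%N.
Proof.
have geq_total : total geq by move=> m n; exact: leq_total.
have geq_trans : transitive geq by move=> m n p mn np; exact: leq_trans np mn.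
have srt := sort_sorted geq_total s.
have /permP <- : perm_eq (sort geq s) s by rewrite perm_sort.
case: (sort geq s) srt => [|x [|y t]] //=; first by case: (k <= x)%N.
move=> /andP[_ yt]; rewrite leqNgt => H.
apply: contraTleq H => ky.
have -> : count (leq k) t = 0%N.
  apply/eqP; rewrite -leqn0 leqNgt -has_count; apply/hasPn => z zt.
  rewrite -ltnNge; apply: leq_ltn_trans ky.
  by have /allP := order_path_min geq_trans yt; exact.
have -> : (k <= y)%N = false by rewrite leqNgt ky.
by case: (k <= x)%N.
Qed.

Lemma leq_L2 (R : realType) (rad : R) (V : {fset R * R}) (k : nat) :
  (1 < #|[set C in components rad V | (k <= #|C|)%N]%SET|)%N -> (k <= L2 rad V)%N.
Proof.
move=> H; apply: leq_nth1_sort; rewrite count_map -size_filter.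
apply: leq_trans H _; rewrite cardE; apply: uniq_leq_size; first exact: enum_uniq.
by move=> C; rewrite mem_enum inE mem_filter mem_enum andbC.
Qed.

End SecondLargest.

Section Components.
Context {R : realType}.
Variables (rad : R) (V : {fset R * R}).

Lemma npoints_card {d} {Om : measurableType d} (W : Om -> {fset R * R}) (A : set (R * R)) w :
  W w = V -> npoints (T := (measurableTypeR R * measurableTypeR R)%type) W A w =
  #|[set v : V | val v \in A]%SET|.
Proof.
rewrite /npoints => ->; rewrite -(@card_fsub _ V); last first.
  by apply/fsubsetP => x; rewrite !inE /= => /andP[].
by apply: eq_card => v; rewrite !inE /= fsvalP.
Qed.

(* The component of [c i] stays inside [S i], so distinct [i] give distinct
   components. *)
Lemma leq_card_components (I : finType) (c : I -> V) (S : I -> set (R * R)) (k : nat) :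
  (forall i, S i (val (c i))) ->
  trivIset [set: I] S ->
  (forall i (u v : V), S i (val u) -> hrg_adj rad u v -> S i (val v)) ->
  (forall i, (k <= #|[set v : V | hrg_adj rad (c i) v]%SET|)%N) ->
  (#|I| <= #|[set C in components rad V | (k <= #|C|)%N]%SET|)%N.
Proof.
move=> Sc tS Sadj leaves.
pose comp i := [set v in [set: V] | connect (@hrg_adj R rad V) (c i) v]%SET.
have compP i v : v \in comp i -> S i (val v).
  rewrite !inE /= => /connectP[p + ->].
  elim: p (c i) (Sc i) => [//|x p IH] y Sy /= /andP[yx px].
  exact: IH (Sadj _ _ _ Sy yx) px.
have comp_inj : injective comp.
  move=> i j ij; apply: (tS i j) => //; exists (val (c j)); split; last exact: Sc.
  by apply: compP; rewrite ij !inE /= connect0.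
rewrite -(card_imset _ comp_inj); apply: subset_leq_card.
apply/fintype.subsetP => _ /imsetP[i _ ->]; rewrite inE; apply/andP; split.
  by apply/imsetP; exists (c i).
apply: leq_trans (leaves i) _; apply: subset_leq_card.
by apply/fintype.subsetP => v; rewrite !inE /= => /connect1.
Qed.

End Components.

(** * Measure of the Poisson intensity *)

Definition plane (R : realType) : measurableType _ :=
  (measurableTypeR R * measurableTypeR R)%type.

Lemma measurable_patch_cst d (T : measurableType d) (R : realType) (D : set T)
  (k : \bar R) : measurable D -> measurable_fun setT (cst k \_ D).
Proof. by move=> mD; apply: (measurable_restrictT _ mD).1. Qed.

Section ProductIntegral.
Context {R : realType}.
Notation leb2 := ((@lebesgue_measure R) \x (@lebesgue_measure R))%E.

(** Tonelli: the section at radius r integrates to at most c r times the length of [J r]. Two radial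
    pieces are allowed because the estimate for the moat changes form at one radius. *)
Lemma integral_le_sections (f : plane R -> \bar R) (J : R -> set (measurableTypeR R)) (c : R -> R)
    (x y z h1 h2 : R) :
  x <= y <= z -> 0 <= h1 -> 0 <= h2 ->
  measurable_fun setT f -> (forall p, 0 <= f p)%E ->
  (forall r, measurable (J r)) -> (forall r, 0 <= c r) ->
  (forall r th, f (r, th) != 0%E -> x <= r < z /\ J r th) ->
  (forall r th, f (r, th) <= (c r)%:E)%E ->
  (forall r, (x <= r < y)%R -> (c r)%:E * lebesgue_measure (J r) <= h1%:E)%E ->
  (forall r, (y <= r < z)%R -> (c r)%:E * lebesgue_measure (J r) <= h2%:E)%E ->
  (\int[leb2]_p f p <= (h1 * (y - x) + h2 * (z - y))%:E)%E.
Proof.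
move=> /andP[xy yz] h10 h20 mf f0 mJ c0 fJ fc hy hz; rewrite fubini_tonelli1 //.
pose H (r : R) : \bar R :=
  ((cst h1%:E) \_ `[x, y[ r + (cst h2%:E) \_ `[y, z[ r)%E.
have mH1 : measurable_fun [set: R] (cst h1%:E \_ `[x, y[).
  by apply: measurable_patch_cst; exact: measurable_itv.
have mH2 : measurable_fun [set: R] (cst h2%:E \_ `[y, z[).
  by apply: measurable_patch_cst; exact: measurable_itv.
apply: (@le_trans _ _ (\int[lebesgue_measure]_r H r)%E).
  apply: ge0_le_integral => //.
  - by move=> r _; apply: integral_ge0.
  - exact: measurable_fun_fubini_tonelli_F.
  - exact: emeasurable_funD.
  move=> r _; rewrite /fubini_F.
  have in_le : (\int[lebesgue_measure]_th f (r, th) <=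
      (c r)%:E * lebesgue_measure (J r))%E.
    rewrite -(integral_cst _ (mJ r)) [X in (_ <= X)%E]integral_mkcond.
    apply: ge0_le_integral => //.
    - exact: measurableT_comp mf (pair1_measurable _).
    - exact: measurable_patch_cst.
    - move=> th _; rewrite patchE; case: ifPn => [_|]; first exact: fc.
      move/negP => nJ; have [->//|nz] := eqVneq (f (r, th)) 0%E.
      by case: nJ; rewrite inE; case: (fJ r th nz).
  have [rx|rx] := boolP (x <= r < z); last first.
    rewrite integral0_eq; last first.
      move=> th _; apply/eqP/negPn/negP => /fJ[rr _].
      by rewrite rr in rx.
    by rewrite /H adde_ge0 // patchE; case: ifP => // _; rewrite lee_fin.
  apply: le_trans in_le _; rewrite /H !patchE !mem_setE !in_itv /=.
  have [ry|ry] := ltP r y.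
    rewrite (_ : (x <= r) = true) /=; last by case/andP: rx.
    by rewrite addr0; apply: hy; rewrite ry andbT; case/andP: rx.
  rewrite andbF /= (_ : (r < z) = true) /=; last by case/andP: rx.
  by rewrite add0r; apply: hz; rewrite ry; case/andP: rx.
rewrite ge0_integralD //; last 2 first.
- by move=> r _; rewrite patchE; case: ifP => // _; rewrite lee_fin.
- by move=> r _; rewrite patchE; case: ifP => // _; rewrite lee_fin.
rewrite -!integral_mkcond !integral_cst //= !lebesgue_measure_itv /= !lte_fin.
have lebE (s t : R) : s <= t -> (if (s < t)%R then t%:E - s%:E else 0)%E = (t - s)%:E.
  by case: ltgtP => // ->; rewrite subrr.
by rewrite !lebE // EFinD !EFinM.
Qed.

Lemma integral_ge_box (f : plane R -> \bar R) (x y a b c : R) :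
  x <= y -> a <= b -> 0 <= c ->
  measurable_fun setT f -> (forall p, 0 <= f p)%E ->
  (forall r th, (x <= r < y)%R -> (a < th < b)%R -> c%:E <= f (r, th))%E ->
  ((c * ((y - x) * (b - a)))%:E <= \int[leb2]_p f p)%E.
Proof.
move=> xy ab c0 mf f0 cf.
pose B : set (plane R) := (`[x, y[ : set R) `*` (`]a, b[ : set R).
have mB : measurable B by apply: measurableX; exact: measurable_itv.
apply: (@le_trans _ _ (\int[leb2]_(p in B) f p)%E); last first.
  by apply: ge0_subset_integral.
have lebE (s t : R) : s <= t -> (if (s < t)%R then t%:E - s%:E else 0)%E = (t - s)%:E.
  by case: ltgtP => // ->; rewrite subrr.
have -> : ((c * ((y - x) * (b - a)))%:E = \int[leb2]_(p in B) (cst c%:E) p)%E.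
  rewrite integral_cst // !EFinM; congr (_ * _)%E.
  have := @product_measure1E _ _ _ _ R (@lebesgue_measure R) (@lebesgue_measure R)
    `[x, y[%classic `]a, b[%classic (measurable_itv _) (measurable_itv _).
  by rewrite /= !lebesgue_measure_itv /= !lte_fin !lebE // => <-.
apply: ge0_le_integral => //.
- exact: measurable_funTS.
- by move=> [r th] [/=]; rewrite !in_itv /= => rr tt; exact: cf.
Qed.

End ProductIntegral.

Section Intensity.
Context {R : realType}.
Variables (nu : R) (n : nat).
Hypothesis nu_gt0 : 0 < nu.
Local Notation rad := (hrg_radius nu n).
Hypothesis rad_ge2 : 2 <= rad.
Implicit Types (A : set (plane R)) (p : plane R).

Lemma intensityE p : disk rad p -> intensity 1 nu n p =
  nu * expR (rad / 2) * ((2 * pi)^-1 * (sinh p.1 / (cosh rad - 1))).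
Proof.
by move=> [r0 _]; rewrite /intensity /radial_density r0 !mul1r.
Qed.

Lemma cosh_rad_bounds : expR rad / 4 <= cosh rad - 1 <= expR rad.
Proof.
have r2 := rad_ge2.
have e4 : 4 <= expR rad.
  have h : 2 <= expR (rad / 2) by have := expR_ge1Dx (rad / 2); lra.
  have -> : expR rad = expR (rad / 2) * expR (rad / 2) by rewrite -expRD; congr expR; lra.
  nra.
by have := expR_le_cosh rad; have := @cosh_le_expR R rad; lra.
Qed.

(** For alpha = 1 the density is of order nu e^(rad/2) e^(r - rad), whence the exponent r - rad / 2
    here and in [intensity_ge]. *)
Lemma intensity_le p : disk rad p -> intensity 1 nu n p <= nu * expR (p.1 - rad / 2).
Proof.
have r2 := rad_ge2; have nu0 := nu_gt0.
move=> dp; rewrite intensityE //; have [/andP[r0 rR] _] := dp.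
have /andP[c1 _] := cosh_rad_bounds.
have c0 : 0 < cosh rad - 1 by have := expR_gt0 rad; lra.
have -> : p.1 - rad / 2 = rad / 2 + (p.1 - rad) by lra.
rewrite expRD mulrA ler_wpM2l ?mulr_ge0 ?expR_ge0 //; first exact: ltW.
have pi2 := pi_ge2 R.
have pi4 : (2 * pi)^-1 <= 4^-1 :> R by rewrite lef_pV2 ?posrE; lra.
apply: (@le_trans _ _ (4^-1 * (expR p.1 / 2 / (expR rad / 4)))).
  rewrite ler_pM //.
  - by rewrite invr_ge0; lra.
  - by rewrite divr_ge0 ?sinh_ge0 // ltW.
  - apply: ler_pM; [exact: sinh_ge0|by rewrite invr_ge0 ltW|exact: sinh_le_expR|].
    by have eR := expR_gt0 rad; rewrite lef_pV2 ?posrE; lra.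
rewrite expRD expRN; have := expR_gt0 p.1; have := expR_gt0 rad.
move=> eR ep; rewrite (_ : 4^-1 * _ = (expR p.1 / expR rad) / 2); last first.
  by field; rewrite gt_eqF.
have := divr_gt0 ep eR; lra.
Qed.

Lemma intensity_ge p : disk rad p -> 1 <= p.1 ->
  nu / 32 * expR (p.1 - rad / 2) <= intensity 1 nu n p.
Proof.
move=> dp p1; rewrite intensityE //; have [/andP[r0 rR] _] := dp.
have /andP[c1 c2] := cosh_rad_bounds.
have eR := expR_gt0 rad; have ep := expR_gt0 p.1.
have c0 : 0 < cosh rad - 1 by lra.
have -> : nu / 32 * expR (p.1 - rad / 2) =
    nu * expR (rad / 2) * (32^-1 * expR (p.1 - rad)).
  by rewrite (_ : p.1 - rad / 2 = rad / 2 + (p.1 - rad)) ?expRD; [field|lra].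
rewrite ler_wpM2l ?mulr_ge0 ?expR_ge0 //; first exact: ltW.
have pi2 := pi_ge2 R; have pi4 := pihalf_lt2 R.
have pi8 : 8^-1 <= (2 * pi)^-1 :> R by rewrite lef_pV2 ?posrE; lra.
have -> : 32^-1 * expR (p.1 - rad) = 8^-1 * (expR p.1 / 4 / expR rad).
  by rewrite expRD expRN; field; rewrite gt_eqF.
apply: ler_pM => //.
apply: ler_pM; rewrite ?invr_ge0 ?divr_ge0 ?expR_ge0 ?expR_le_sinh //.
by rewrite lef_pV2 ?posrE.
Qed.

Lemma intensity_ge0 p : disk rad p -> 0 <= intensity 1 nu n p.
Proof.
have r2 := rad_ge2; have nu0 := nu_gt0.
move=> dp; rewrite intensityE //; have [/andP[r0 _] _] := dp.
have /andP[c1 _] := cosh_rad_bounds; have eR := expR_gt0 rad.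
have pi2 := pi_ge2 R.
apply: mulr_ge0; first by rewrite mulr_ge0 ?expR_ge0 // ltW.
rewrite mulr_ge0 ?invr_ge0 //; first lra.
rewrite divr_ge0 ?sinh_ge0 //; lra.
Qed.

Lemma measurable_disk : measurable (disk rad : set (plane R)).
Proof.
have -> : disk rad = (`[0, rad[%classic `*` `[0, 2 * pi[%classic) :> set (plane R).
  by apply/seteqP; split=> p [] /=; rewrite ?in_itv /=.
by apply: measurableX; exact: measurable_itv.
Qed.

(** Extension by zero, so that integrals over a subset of the disk become integrals over the plane,
    as the product lemmas require. *)
Let fA A : plane R -> \bar R :=
  (fun p => (intensity 1 nu n p)%:E) \_ (A `&` disk rad).

Lemma intensity_measureE A :
  intensity_measure 1 nu n A = (\int[lebesgue_measure \x lebesgue_measure]_p fA A p)%E.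
Proof. by rewrite /intensity_measure integral_mkcond. Qed.

Lemma fA_ge0 A p : (0 <= fA A p)%E.
Proof.
rewrite /fA patchE; case: ifPn => // /set_mem[_ dp].
by rewrite lee_fin intensity_ge0.
Qed.

Lemma measurable_fA A : measurable A -> measurable_fun setT (fA A).
Proof.
move=> mA; have mD : measurable (A `&` disk rad).
  by apply: measurableI => //; exact: measurable_disk.
apply: (measurable_restrictT _ mD).1; apply/measurable_EFinP.
(* On the disk the case distinction of [radial_density] disappears and an explicit formula
   remains. *)
apply: (eq_measurable_fun (fun p : plane R => nu * expR (rad / 2) *
  ((2 * pi)^-1 * (sinh p.1 / (cosh rad - 1))))).
  by move=> p /set_mem[_ dp]; rewrite intensityE.
apply: measurable_funTS; apply: measurable_funM => //.
apply: measurable_funM => //; apply: measurable_funM => //.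
apply: (measurableT_comp (f := sinh)); last exact: measurable_fst.
apply: measurable_funM => //; apply: measurable_funB; first exact: measurable_expR.
by apply: measurableT_comp; [exact: measurable_expR|exact: oppr_measurable].
Qed.

Lemma intensity_measure_le A (J : R -> set (measurableTypeR R)) (x y h1 h2 : R) :
  0 <= x <= y -> y <= rad -> 0 <= h1 -> 0 <= h2 -> measurable A ->
  (forall r, measurable (J r)) ->
  (forall p, A p -> disk rad p -> x <= p.1 /\ J p.1 p.2) ->
  (forall r, x <= r < y ->
    ((nu * expR (r - rad / 2))%:E * lebesgue_measure (J r) <= h1%:E)%E) ->
  (forall r, y <= r < rad ->
    ((nu * expR (r - rad / 2))%:E * lebesgue_measure (J r) <= h2%:E)%E) ->
  (intensity_measure 1 nu n A <= (h1 * (y - x) + h2 * (rad - y))%:E)%E.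
Proof.
move=> /andP[x0 xy] yR h10 h20 mA mJ AJ hy hz; rewrite intensity_measureE.
have c0 r : 0 <= nu * expR (r - rad / 2) by rewrite mulr_ge0 ?expR_ge0 // ltW.
apply: (integral_le_sections (J := J) (c := fun r => nu * expR (r - rad / 2))) => //.
- by rewrite xy.
- exact: measurable_fA.
- exact: fA_ge0.
- move=> r th; rewrite /fA patchE; case: ifPn => [/set_mem[Ap dp] _|_]; last by rewrite eqxx.
  have [xr Jth] := AJ _ Ap dp; split => //; rewrite xr /=.
  by have [/andP[]] := dp.
- move=> r th; rewrite /fA patchE; case: ifPn => [/set_mem[Ap dp]|_]; last by rewrite lee_fin.
  by rewrite lee_fin; have := intensity_le dp.
Qed.

Lemma lebesgue_itv_cc (s t : R) : s <= t ->
  lebesgue_measure (`[s, t]%classic : set (measurableTypeR R)) = (t - s)%:E.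
Proof.
rewrite le_eqVlt => /predU1P[->|st]; rewrite lebesgue_measure_itv /= lte_fin.
  by rewrite ltxx subrr.
by rewrite st.
Qed.

(** [fine] sends an infinite measure to 0, so finiteness is what gives the Poisson parameter its
    meaning. *)
Lemma intensity_measure_fin A : measurable A -> intensity_measure 1 nu n A \is a fin_num.
Proof.
have r2 := rad_ge2; have nu0 := nu_gt0.
move=> mA; have pi4 := pihalf_lt2 R; have pi2 := pi_ge2 R.
have h0 : 0 <= nu * expR (rad / 2) * 8 by rewrite !mulr_ge0 ?expR_ge0 // ltW.
(* The angle ranges over [0, 2 pi), inside [0, 8]; cutting at [rad] leaves the second radial piece
   empty. *)
have := @intensity_measure_le A (fun=> `[0, 8]%classic) 0 rad (nu * expR (rad / 2) * 8) 0.
have mu0 : (0 <= intensity_measure 1 nu n A)%E.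
  by rewrite intensity_measureE; apply: integral_ge0 => p _; exact: fA_ge0.
move=> H; rewrite ge0_fin_numE //; apply: le_lt_trans (H _ _ _ _ _ _ _ _ _) (ltry _) => //.
- lra.
- by move=> [r th] _ [/= /andP[r0 _] /andP[t0 t1]]; split => //; rewrite in_itv /=; lra.
- move=> r /andP[r0 rR]; rewrite lebesgue_itv_cc // subr0 -EFinM lee_fin.
  by rewrite ler_wpM2r // ler_wpM2l ?ler_expR //; [exact: ltW|lra].
- by move=> r /andP[a b]; have := le_lt_trans a b; rewrite ltxx.
Qed.

Lemma intensity_measure_ge0 A : 0 <= fine (intensity_measure 1 nu n A).
Proof.
by rewrite fine_ge0 // intensity_measureE; apply: integral_ge0 => p _; exact: fA_ge0.
Qed.

Lemma intensity_measure_ge_box A (x y a b : R) :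
  1 <= x <= y -> y <= rad -> 0 <= a <= b -> b <= 2 * pi -> measurable A ->
  (forall p, x <= p.1 < y -> a < p.2 < b -> A p) ->
  nu / 32 * expR (x - rad / 2) * ((y - x) * (b - a)) <=
    fine (intensity_measure 1 nu n A).
Proof.
have r2 := rad_ge2; have nu0 := nu_gt0.
move=> /andP[x1 xy] yR /andP[a0 ab] bpi mA boxA.
rewrite -lee_fin fineK ?intensity_measure_fin // intensity_measureE.
have n32 : 0 <= nu / 32 by rewrite divr_ge0 // ltW.
apply: integral_ge_box => //.
- by rewrite mulr_ge0 ?expR_ge0.
- exact: measurable_fA.
- exact: fA_ge0.
- move=> r th /andP[xr ry] /andP[at_ tb].
  have dp : disk rad (r, th) by split => /=; lra.
  have Ap : A (r, th) by apply: boxA => /=; lra.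
  rewrite /fA patchE mem_set // lee_fin; apply: le_trans (intensity_ge dp _) => /=; last lra.
  by rewrite ler_wpM2l // ler_expR; lra.
Qed.

End Intensity.

(** * Isolated stars *)

Section Sector.
Context {R : realType}.
Variables (rad h th : R).
Implicit Types (p u v : plane R).

(** The value of 4 e^(rad/2 - r) at r = rad - 2 h, just below the radii of the hub. *)
Definition sector_halfwidth : R := 4 * expR (2 * h - rad / 2).
(** By [hdist_small] a point of radius about rad - 2 h reaches boundary points within an angle of
    order e^(h - rad/2); the -2 absorbs the constants in [hub_leaves_adjacent]. *)
Definition star_halfwidth : R := expR (h - rad / 2 - 2).
(* With t(r) = 4 e^(rad/2 - r), points of radii r, r' at angular distance more
   than 2 sqrt(t(r) t(r')) are not adjacent.  The width is
   min(2 t(r), 2 sqrt(phi t(r))), phi being the half-width of the sector: the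
   second term suffices because every point of the sector outside the moat has
   t < phi. *)
Definition moat_width (r : R) : R :=
  8 * Num.min (expR (rad / 2 - r)) (expR (h - r / 2)).

Definition sector : set (plane R) :=
  [set p | `|p.2 - th| < sector_halfwidth].
Definition hub : set (plane R) :=
  [set p | rad - 2 * h + 2 <= p.1 < rad - 2 * h + 3 /\
           th - star_halfwidth < p.2 < th + star_halfwidth].
Definition leaves : set (plane R) :=
  [set p | rad - 1 <= p.1 < rad /\
           th - star_halfwidth < p.2 < th + star_halfwidth].
(** The nested absolute values describe strips around both edges of the sector. Angles are used
    unreduced, which is safe because the centres will lie in [1, 2], away from the cut at angle
    0. *)
Definition moat : set (plane R) :=
  [set p | rad / 4 <= p.1 < rad /\
           `| `|p.2 - th| - sector_halfwidth| <= moat_width p.1].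

Hypothesis rad_ge : 200 <= rad.
Hypothesis h_ge : 4 <= h.
Hypothesis h_le : h <= rad / 256.

Lemma expR_nat_ge2 (n : nat) : 2 ^+ n <= expR n%:R :> R.
Proof.
rewrite -[n%:R]mulr1 expRM_natl lerXn2r ?nnegrE ?expR_ge0 //.
by have := expR_ge1Dx (1 : R); lra.
Qed.

Lemma star_le_sector : 16 * star_halfwidth <= sector_halfwidth.
Proof.
rewrite /star_halfwidth /sector_halfwidth.
have -> : 2 * h - rad / 2 = (h + 2) + (h - rad / 2 - 2) by lra.
rewrite [in leRHS]expRD; have e0 := expR_gt0 (h - rad / 2 - 2).
have : 4 <= expR (h + 2).
  by have := expR_nat_ge2 2; rewrite -natrX => /le_trans; apply; rewrite ler_expR; have := h_ge; lra.
nra.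
Qed.

Lemma sector_halfwidth_gt0 : 0 < sector_halfwidth.
Proof. by rewrite mulr_gt0 ?expR_gt0. Qed.

Lemma star_halfwidth_gt0 : 0 < star_halfwidth.
Proof. exact: expR_gt0. Qed.

Lemma moat_width_ge0 r : 0 <= moat_width r.
Proof. by rewrite mulr_ge0 // le_min !expR_ge0. Qed.

(** The reason for the shift by 2 in [hub]: e^(-2) <= 1/4 makes the strips reach at most half way to
    the axis of the sector, whereas the star fills at most a sixteenth. *)
Lemma moat_width_small r : rad - 2 * h + 2 <= r -> moat_width r <= sector_halfwidth / 2.
Proof.
move=> rr; rewrite /moat_width /sector_halfwidth.
apply: (@le_trans _ _ (8 * expR (rad / 2 - r))).
  by rewrite ler_wpM2l // ge_min lexx.
have : expR (rad / 2 - r) <= expR (- 2) * expR (2 * h - rad / 2).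
  by rewrite -expRD ler_expR; lra.
have e2 : expR (- 2) <= 4^-1 :> R.
  by rewrite expRN lef_pV2 ?posrE ?expR_gt0 //; have := expR_nat_ge2 2; rewrite -natrX.
have e0 := expR_gt0 (2 * h - rad / 2).
nra.
Qed.

(** The right side is half the spacing of the sector centres, so regions of distinct sectors will be
    disjoint. Radii below rad / 4 are excluded because the width, of order e^(h - r/2), would be too
    large there. *)
Lemma sector_moat_width r : rad / 4 <= r ->
  sector_halfwidth + moat_width r < expR (- (rad / 32)) / 2.
Proof.
move=> rr; have r0 := rad_ge; have h0 := h_ge; have h1 := h_le.
have m8 : moat_width r <= 8 * expR (h - rad / 8).
  rewrite /moat_width ler_wpM2l // ge_min; apply/orP; right.
  by rewrite ler_expR; lra.
have s4 : sector_halfwidth <= 4 * expR (h - rad / 8).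
  by rewrite /sector_halfwidth ler_wpM2l // ler_expR; lra.
have : expR 5 * expR (h - rad / 8) <= expR (- (rad / 32)).
  by rewrite -expRD ler_expR; lra.
have e5 := expR_nat_ge2 5; have e0 := expR_gt0 (h - rad / 8).
have : 32 <= expR 5 :> R by apply: le_trans e5; rewrite -natrX.
nra.
Qed.

Lemma hub_leaves_disjoint p : hub p -> leaves p -> False.
Proof. by move=> [/andP[_ a] _] [/andP[b _] _]; have := h_ge; lra. Qed.

Lemma star_moat_disjoint p : rad - 2 * h + 2 <= p.1 ->
  th - star_halfwidth < p.2 < th + star_halfwidth -> ~ moat p.
Proof.
move=> p1 p2 [_]; have := moat_width_small p1.
have := star_le_sector; have := star_halfwidth_gt0.
have : `|p.2 - th| < star_halfwidth by rewrite ltr_norml; lra.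
move: `|p.2 - th| => x; rewrite ler_norml; lra.
Qed.

Lemma hub_moat_disjoint p : hub p -> moat p -> False.
Proof. by move=> [/andP[a _] b]; apply: star_moat_disjoint. Qed.

Lemma leaves_moat_disjoint p : leaves p -> moat p -> False.
Proof.
by move=> [/andP[a _] b]; apply: star_moat_disjoint => //; have := h_ge; lra.
Qed.

Lemma star_angle p : th - star_halfwidth < p.2 < th + star_halfwidth ->
  `|p.2 - th| < expR (- (rad / 32)) / 2.
Proof.
move=> p2; have : `|p.2 - th| < star_halfwidth by rewrite ltr_norml; lra.
have := @sector_moat_width (rad / 4) (lexx _); have := moat_width_ge0 (rad / 4).
have := star_le_sector; have := star_halfwidth_gt0; lra.
Qed.

Lemma moat_angle p : moat p -> `|p.2 - th| < expR (- (rad / 32)) / 2.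
Proof.
move=> [/andP[p1 _]]; have := sector_moat_width p1.
move: `|p.2 - th| => x; rewrite ler_norml; lra.
Qed.

Lemma hub_sector p : hub p -> sector p.
Proof.
move=> [_ p2]; rewrite /sector /=.
have : `|p.2 - th| < star_halfwidth by rewrite ltr_norml; lra.
have := star_le_sector; have := star_halfwidth_gt0; lra.
Qed.

Lemma sector_angle p : sector p -> `|p.2 - th| < expR (- (rad / 32)) / 2.
Proof.
rewrite /sector /= => ps.
have := @sector_moat_width (rad / 4) (lexx _); have := moat_width_ge0 (rad / 4).
lra.
Qed.

Lemma hub_leaves_adjacent u v : hub u -> leaves v -> hdist u v <= rad.
Proof.
have r0 := rad_ge; have h0 := h_ge; have h1 := h_le.
move=> [/andP[u1 u1'] u2] [/andP[v1 v1'] v2].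
have e2 := expR_nat_ge2 2; have e1 := expR_nat_ge2 1.
apply: hdist_small; [lra|lra| |].
  have : expR 2 * expR (v.1 - u.1) <= expR rad by rewrite -expRD ler_expR; lra.
  have := expR_gt0 (v.1 - u.1); move: e2; rewrite -natrX.
  nra.
(* Two points of a star differ in angle by less than twice its half-width; the remaining factor 2 is
   paid by e >= 2. *)
have d2 : (u.2 - v.2) ^+ 2 <= 4 * expR (2 * h - rad - 4).
  have -> : 2 * h - rad - 4 = (h - rad / 2 - 2) + (h - rad / 2 - 2) by lra.
  rewrite expRD -/star_halfwidth; move: u2 v2; set s := star_halfwidth.
  by move=> /andP[? ?] /andP[? ?]; nra.
have s1 : expR (u.1 + v.1) <= expR (2 * rad - 2 * h + 3) by rewrite ler_expR; lra.
apply: (@le_trans _ _ (expR (2 * rad - 2 * h + 3) * (4 * expR (2 * h - rad - 4)))).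
  by apply: ler_pM; rewrite ?expR_ge0 ?sqr_ge0.
have : expR 1 * (expR (2 * rad - 2 * h + 3) * expR (2 * h - rad - 4)) = expR rad.
  by rewrite -!expRD; congr expR; lra.
have := mulr_gt0 (expR_gt0 (2 * rad - 2 * h + 3)) (expR_gt0 (2 * h - rad - 4)).
move: e1; rewrite expr1; nra.
Qed.

(** Both points keep their own moat width from the edge between them, so their angular distance
    exceeds the sum of the two widths, and this sum is at least the threshold of [hdist_gt]. *)
Lemma no_crossing u v : 1 <= th <= 2 ->
  rad / 4 <= u.1 -> rad / 4 <= v.1 -> disk rad u -> disk rad v ->
  sector u -> ~ moat u -> ~ sector v -> ~ moat v -> rad < hdist u v.
Proof.
have r0 := rad_ge; have h0 := h_ge; have h1 := h_le.
move=> /andP[th1 th2] u1 v1 [/andP[_ uR] _] [/andP[_ vR] /andP[v20 v2pi]] su mu sv mv.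
have s0 := sector_halfwidth_gt0.
have {mu} mu : `|u.2 - th| < sector_halfwidth - moat_width u.1.
  rewrite ltNge; apply/negP => H; apply: mu; split; first by rewrite u1.
  move: su H; rewrite /sector /=; move: `|u.2 - th| (moat_width_ge0 u.1) => x m0 xs H.
  by rewrite ler_norml; lra.
have {sv mv} mv : sector_halfwidth + moat_width v.1 < `|v.2 - th|.
  rewrite ltNge; apply/negP => H; apply: mv; split; first by rewrite v1.
  move: sv H; rewrite /sector /=; move: `|v.2 - th| (moat_width_ge0 v.1) => x m0 xs H.
  by rewrite ler_norml; lra.
(* At a smaller radius both terms of the minimum are at least e^(2 h - rad/2), so the moat width
   would be at least twice the half-width of the sector, leaving no room for [u]. *)
have u1' : rad - 2 * h < u.1.
  rewrite ltNge; apply/negP => H.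
  have : moat_width u.1 < sector_halfwidth by have := normr_ge0 (u.2 - th); lra.
  apply/negP; rewrite -leNgt /moat_width /sector_halfwidth.
  have : expR (2 * h - rad / 2) <= Num.min (expR (rad / 2 - u.1)) (expR (h - u.1 / 2)).
    by rewrite le_min !ler_expR; lra.
  have := expR_gt0 (2 * h - rad / 2); lra.
have mu1 : moat_width u.1 = 8 * expR (rad / 2 - u.1).
  by rewrite /moat_width min_l // ler_expR; lra.
(* The solution of 64 e^rad = e^(u.1 + v.1) d^2, the borderline case of [hdist_gt]. *)
set d := 8 * expR ((rad - u.1 - v.1) / 2).
have d0 : 0 <= d by rewrite mulr_ge0 ?expR_ge0.
have d2 : d <= 1 / 2.
  have : expR 4 * expR ((rad - u.1 - v.1) / 2) <= 1.
    by rewrite -expRD -[leRHS]expR0 ler_expR; lra.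
  have := expR_nat_ge2 4; rewrite -natrX; have := expR_gt0 ((rad - u.1 - v.1) / 2).
  rewrite /d; nra.
have dm : d <= moat_width u.1 + moat_width v.1.
  rewrite mu1 /moat_width minElt; case: ifPn => [_|_].
    rewrite /d.
    have -> : expR (rad / 2 - u.1) = expR ((rad / 2 - u.1) / 2) ^+ 2.
      by rewrite expr2 -expRD; congr expR; lra.
    have -> : expR (rad / 2 - v.1) = expR ((rad / 2 - v.1) / 2) ^+ 2.
      by rewrite expr2 -expRD; congr expR; lra.
    have -> : expR ((rad - u.1 - v.1) / 2) =
        expR ((rad / 2 - u.1) / 2) * expR ((rad / 2 - v.1) / 2).
      by rewrite -expRD; congr expR; lra.
    (* AM-GM *)
    have := sqr_ge0 (expR ((rad / 2 - u.1) / 2) - expR ((rad / 2 - v.1) / 2)).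
    have := sqr_ge0 (expR ((rad / 2 - u.1) / 2) + expR ((rad / 2 - v.1) / 2)).
    lra.
  (* Here the second term is the minimum at [v]; it suffices alone, since rad - u.1 < 2 h. *)
  have : expR ((rad - u.1 - v.1) / 2) <= expR (h - v.1 / 2) by rewrite ler_expR; lra.
  have := expR_gt0 (rad / 2 - u.1); rewrite /d; lra.
have du : d <= `|u.2 - v.2|.
  have : `|v.2 - th| <= `|u.2 - th| + `|u.2 - v.2|.
    have -> : v.2 - th = (u.2 - th) - (u.2 - v.2) by lra.
    exact: ler_normB.
  lra.
(* Rules out closeness across angle 0: [u.2] lies in (1/2, 5/2) and [v.2] in [0, 2 pi), so the
   difference is at most 2 pi - 1/2. *)
have half : `|u.2 - th| < 1 / 2.
  apply: lt_le_trans (sector_angle su) _.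
  have : expR (- (rad / 32)) <= 1 by rewrite -[leRHS]expR0 ler_expR; lra.
  lra.
apply: (hdist_gt (d := d)).
- by apply: le_trans u1; lra.
- by apply: le_trans v1; lra.
- exact: le_trans (ler0n R 200) r0.
- by rewrite d0 (le_trans d2) //; lra.
- rewrite du /=; move: half; rewrite ltr_norml => /andP[ha hb].
  have pi2 := pi_ge2 R; rewrite ler_norml; lra.
- rewrite /d exprMn (_ : expR ((rad - u.1 - v.1) / 2) ^+ 2 = expR (rad - u.1 - v.1)); last first.
  by rewrite expr2 -expRD; congr expR; lra.
rewrite (mulrCA (expR (u.1 + v.1))) -expRD.
have -> : u.1 + v.1 + (rad - u.1 - v.1) = rad by lra.
by rewrite -natrX.
Qed.

Lemma measurable_hub : measurable hub.
Proof.
have -> : hub = (`[rad - 2 * h + 2, rad - 2 * h + 3[%classic `*`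
    `]th - star_halfwidth, th + star_halfwidth[%classic) :> set (plane R).
  by apply/seteqP; split=> p [] /=; rewrite ?in_itv /=.
by apply: measurableX; exact: measurable_itv.
Qed.

Lemma measurable_leaves : measurable leaves.
Proof.
have -> : leaves = (`[rad - 1, rad[%classic `*`
    `]th - star_halfwidth, th + star_halfwidth[%classic) :> set (plane R).
  by apply/seteqP; split=> p [] /=; rewrite ?in_itv /=.
by apply: measurableX; exact: measurable_itv.
Qed.

Lemma measurable_moat : measurable moat.
Proof.
pose f (p : plane R) : R := `| `|p.2 - th| - sector_halfwidth| - moat_width p.1.
have m1 : measurable_fun setT (fun p : plane R => p.1 : R) := measurable_fst.
have m2 : measurable_fun setT (fun p : plane R => p.2 : R) := measurable_snd.
have e1 : measurable_fun setT (fun p : plane R => expR (rad / 2 - p.1)) :=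
  measurableT_comp (@measurable_expR R) (measurable_funB (measurable_cst _) m1).
have e2 : measurable_fun setT (fun p : plane R => expR (h - p.1 / 2)) :=
  measurableT_comp (@measurable_expR R)
    (measurable_funB (measurable_cst _) (measurable_funM m1 (measurable_cst _))).
have n1 : measurable_fun setT (fun p : plane R => `|p.2 - th|) :=
  measurableT_comp (@normr_measurable R setT) (measurable_funB m2 (measurable_cst _)).
have n2 : measurable_fun setT (fun p : plane R => `| `|p.2 - th| - sector_halfwidth|) :=
  measurableT_comp (@normr_measurable R setT) (measurable_funB n1 (measurable_cst _)).
have mf : measurable_fun setT f :=
  measurable_funB n2 (measurable_funM (measurable_cst (8 : R)) (measurable_minr e1 e2)).
have -> : moat = (`[rad / 4, rad[%classic `*` setT) `&` f @^-1` `]-oo, 0]%classic.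
  apply/seteqP; split=> p /=.
    by move=> [a b]; rewrite !in_itv /= /f subr_le0.
  by move=> [[a _]]; move: a; rewrite !in_itv /= /f subr_le0.
apply: measurableI; first by apply: measurableX => //; exact: measurable_itv.
rewrite -[X in measurable X]setTI; apply: mf => //; exact: measurable_itv.
Qed.

End Sector.

(** Indexing the three regions by ['I_3] puts the regions of all sectors into one disjoint family,
    to which independence applies once. [star_counts] lists the matching requirements: a hub point,
    at least [K] leaves, an empty moat. *)
Definition star_region {R : realType} (rad h th : R) (k : 'I_3) : set (plane R) :=
  nth set0 [:: hub rad h th; leaves rad h th; moat rad h th] k.

Definition star_counts (K : nat) (k : 'I_3) : set nat :=
  nth set0 [:: ~` [set 0%N]; ~` [set m | (m < K)%N]; [set 0%N]] k.

(** * Expected numbers of points in the hub, the leaves, the moat and the core *)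

Section SectorMeasure.
Context {R : realType}.
Variables (nu : R) (n : nat).
Hypothesis nu_gt0 : 0 < nu.
Local Notation rad := (hrg_radius nu n).
Local Notation mu := (intensity_measure 1 nu n).
Variables (h th : R).
Hypothesis rad_ge : 200 <= rad.
Hypothesis h_ge : 4 <= h.
Hypothesis h_le : h <= rad / 256.
Hypothesis th12 : 1 <= th <= 2.

Let rad_ge2 : 2 <= rad.
Proof. by apply: le_trans rad_ge; rewrite ler_nat. Qed.

Lemma star_halfwidth_lt1 : star_halfwidth rad h < 1.
Proof.
have r0 := rad_ge; have h1 := h_le.
by rewrite /star_halfwidth -[ltRHS]expR0 ltr_expR; lra.
Qed.

(** Density e^(rad/2 - 2 h) times angle e^(h - rad/2), the shifts by 2 cancelling. For the leaves
    the density is e^(rad/2) up to a constant, whence e^h instead of e^(-h). *)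
Lemma hub_measure_ge : nu / 16 * expR (- h) <= fine (mu (hub rad h th)).
Proof.
have r0 := rad_ge; have h0 := h_ge; have h1 := h_le; have /andP[t1 t2] := th12.
have s1 := star_halfwidth_lt1; have s0 := star_halfwidth_gt0 rad h.
have pi2 := pi_ge2 R.
apply: (@le_trans _ _ (nu / 32 * expR (rad - 2 * h + 2 - rad / 2) *
  ((rad - 2 * h + 3 - (rad - 2 * h + 2)) *
   (th + star_halfwidth rad h - (th - star_halfwidth rad h))))); last first.
  apply: intensity_measure_ge_box; rewrite ?nu_gt0 ?rad_ge2 //; try lra.
  exact: measurable_hub.
rewrite [leRHS](_ : _ = nu / 16 * (expR (rad - 2 * h + 2 - rad / 2) * star_halfwidth rad h)).
  by rewrite /star_halfwidth -expRD le_eqVlt; apply/orP; left; apply/eqP; congr (_ * expR _); lra.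
by field.
Qed.

Lemma leaves_measure_ge : nu / 16 * expR (h - 3) <= fine (mu (leaves rad h th)).
Proof.
have r0 := rad_ge; have h0 := h_ge; have h1 := h_le; have /andP[t1 t2] := th12.
have s1 := star_halfwidth_lt1; have s0 := star_halfwidth_gt0 rad h.
have pi2 := pi_ge2 R.
apply: (@le_trans _ _ (nu / 32 * expR (rad - 1 - rad / 2) *
  ((rad - (rad - 1)) *
   (th + star_halfwidth rad h - (th - star_halfwidth rad h))))); last first.
  apply: intensity_measure_ge_box; rewrite ?nu_gt0 ?rad_ge2 //; try lra.
  exact: measurable_leaves.
rewrite [leRHS](_ : _ = nu / 16 * (expR (rad - 1 - rad / 2) * star_halfwidth rad h)).
  by rewrite /star_halfwidth -expRD le_eqVlt; apply/orP; left; apply/eqP; congr (_ * expR _); lra.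
by field.
Qed.

(* The expected number of points of the moat per unit of radius is at most
   32 nu e^(min(0, (r - rad + 2 h) / 2)); the two terms come from cutting at
   r = rad - 6 h. *)
Lemma moat_measure_le :
  fine (mu (moat rad h th)) <= 32 * nu * (expR (- (2 * h)) * rad + 6 * h).
Proof.
have r0 := rad_ge; have h0 := h_ge; have h1 := h_le.
have nu0 := nu_gt0.
pose tau := moat_width rad h; pose phi := sector_halfwidth rad h.
pose J r : set (measurableTypeR R) :=
  `[th - phi - tau r, th - phi + tau r]%classic `|` `[th + phi - tau r, th + phi + tau r]%classic.
have mJ r : measurable (J r) by apply: measurableU; exact: measurable_itv.
have t0 r : 0 <= tau r by exact: moat_width_ge0.
have leJ r : (lebesgue_measure (J r) <= (4 * tau r)%:E)%E.
  apply: le_trans (measureU2 _ _ _) _; try exact: measurable_itv.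
  have tr := t0 r; rewrite /= lebesgue_itv_cc; last lra.
  by rewrite lebesgue_itv_cc -?EFinD ?lee_fin; lra.
have bound r e : 8 * expR (rad / 2 - r) <= e \/ 8 * expR (h - r / 2) <= e ->
    nu * expR (r - rad / 2) * (4 * tau r) <= 4 * nu * (expR (r - rad / 2) * e).
  move=> He; have te : tau r <= e.
    by case: He; apply: le_trans; rewrite ler_wpM2l // ge_min lexx ?orbT.
  have -> : nu * expR (r - rad / 2) * (4 * tau r) = 4 * nu * (expR (r - rad / 2) * tau r) by ring.
  by rewrite ler_wpM2l ?mulr_ge0 ?(ltW nu0) // ler_wpM2l ?expR_ge0.
have small r : r < rad - 6 * h ->
    nu * expR (r - rad / 2) * (4 * tau r) <= 32 * nu * expR (- (2 * h)).
  move=> rr; apply: le_trans (bound r (8 * expR (h - r / 2)) _) _; first by right.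
  rewrite (mulrCA (expR _)) -expRD.
  have : expR (r - rad / 2 + (h - r / 2)) <= expR (- (2 * h)) by rewrite ler_expR; lra.
  move=> le; rewrite (_ : _ * (8 * _) = 32 * nu * expR (r - rad / 2 + (h - r / 2))); last by ring.
  by rewrite ler_wpM2l // mulr_ge0 // ltW.
have large r : nu * expR (r - rad / 2) * (4 * tau r) <= 32 * nu.
  apply: le_trans (bound r (8 * expR (rad / 2 - r)) _) _; first by left.
  rewrite (mulrCA (expR _)) -expRD (_ : r - rad / 2 + (rad / 2 - r) = 0) ?expR0; last lra.
  lra.
have n32 : 0 <= 32 * nu by lra.
have := @intensity_measure_le _ nu n nu_gt0 rad_ge2 (moat rad h th) J (rad / 4)
  (rad - 6 * h) (32 * nu * expR (- (2 * h))) (32 * nu).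
move=> /(_ _ _ _ _ (measurable_moat _ _ _) mJ _ _ _) H.
have {}H : (mu (moat rad h th) <= (32 * nu * expR (- (2 * h)) * (rad - 6 * h - rad / 4)
   + 32 * nu * (rad - (rad - 6 * h)))%:E)%E.
  apply: H.
  - lra.
  - lra.
  - by rewrite mulr_ge0 ?expR_ge0.
  - by [].
  - move=> p [/andP[p1 _] p2] _; split => //; rewrite /J /= !in_itv /=.
    move: p2; rewrite -/(tau _) -/phi ler_norml => /andP[a b].
    by have [c|c] := ler0P (p.2 - th); rewrite ?(ler0_norm c) ?(gtr0_norm c) in a b; [left|right]; lra.
  - move=> r /andP[_ rr].
    apply: (@le_trans _ _ ((nu * expR (r - rad / 2))%:E * (4 * tau r)%:E)%E).
      by apply: lee_wpmul2l => //; rewrite lee_fin mulr_ge0 ?expR_ge0 // ltW.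
    by rewrite -EFinM lee_fin small.
  - move=> r _.
    apply: (@le_trans _ _ ((nu * expR (r - rad / 2))%:E * (4 * tau r)%:E)%E).
      by apply: lee_wpmul2l => //; rewrite lee_fin mulr_ge0 ?expR_ge0 // ltW.
    by rewrite -EFinM lee_fin large.
rewrite -lee_fin fineK; last first.
  apply: intensity_measure_fin; rewrite ?nu_gt0 ?rad_ge2 //; exact: measurable_moat.
apply: le_trans H _; rewrite lee_fin.
have e0 := expR_gt0 (- (2 * h)).
rewrite -(mulrA (32 * nu) (expR _)) -mulrDr ler_wpM2l //.
rewrite (_ : rad - (rad - 6 * h) = 6 * h); last lra.
rewrite lerD2r ler_wpM2l ?(ltW nu0) //; lra.
Qed.

(** The density is at most nu e^(-rad/4) there, the angle at most 8 and the radial length rad / 4.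
    [J] is empty beyond the core, so the second piece contributes 0. *)
Lemma core_measure_le :
  fine (mu [set p | p.1 < rad / 4]) <= 2 * nu * rad * expR (- (rad / 4)).
Proof.
have r0 := rad_ge; have nu0 := nu_gt0; have pi4 := pihalf_lt2 R.
have mcore : measurable ([set p | p.1 < rad / 4] : set (plane R)).
  rewrite (_ : [set p | p.1 < rad / 4] = `]-oo, rad / 4[%classic `*` setT :> set (plane R)).
    by apply: measurableX => //; exact: measurable_itv.
  by apply/seteqP; split=> p /=; rewrite in_itv //=; case.
pose e := 8 * nu * expR (- (rad / 4)).
have e0 : 0 <= e by rewrite !mulr_ge0 ?expR_ge0 // ltW.
pose J r : set (measurableTypeR R) := if r < rad / 4 then `[0, 8]%classic else set0.
have := @intensity_measure_le _ nu n nu_gt0 rad_ge2 [set p | p.1 < rad / 4] J 0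
  (rad / 4) e 0.
move=> /(_ _ _ e0 (lexx _) mcore _ _ _ _) H.
have {}H : (mu [set p | (p.1 < rad / 4)%R] <= (e * (rad / 4 - 0) + 0 * (rad - rad / 4))%:E)%E.
  apply: H.
  - lra.
  - lra.
  - by move=> r; rewrite /J; case: ifP => // _; exact: measurable_itv.
  - move=> [r t] /= rr [/= /andP[r0' _] /andP[t0 t1]]; split => //.
    by rewrite /J rr /= in_itv /=; lra.
  - move=> r /andP[_ rr]; rewrite /J rr lebesgue_itv_cc // subr0 -EFinM lee_fin.
    rewrite /e -(mulrA 8) (mulrC 8) ler_wpM2r // ler_wpM2l ?(ltW nu0) // ler_expR; lra.
  - by move=> r /andP[rr _]; rewrite /J ltNge rr /= measure0 mule0.
rewrite -lee_fin fineK; last by apply: intensity_measure_fin; rewrite ?nu_gt0 ?rad_ge2.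
apply: le_trans H _; rewrite lee_fin /e; lra.
Qed.

End SectorMeasure.

(** * Probability of isolated stars *)

Section GroupedEvents.
Context {d d' : measure_display} {R : realType}.
Context {Om : measurableType d} {T : measurableType d'}.
Variables (P : probability Om R) (mu : set T -> \bar R) (V : Om -> {fset T}).
Hypothesis PV : poisson_process P mu V.
Variables (I J K : finType) (A : I * J * K -> set T) (U : K -> set nat).
Hypothesis mA : forall x, measurable (A x).
Hypothesis tA : trivIset [set: I * J * K] A.

Definition counts_event (ij : I * J) : set Om :=
  [set w | forall k, U k (npoints V (A (ij, k)) w)].

Lemma measurable_counts_event ij : measurable (counts_event ij).
Proof. by apply: measurable_forall => k; exact: (measurable_npoints PV). Qed.

Lemma pr_counts_events (S : seq (I * J)) : uniq S ->
  pr P [set w | forall ij, ij \in S -> counts_event ij w] =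
  \prod_(ij <- S) \prod_k pr P (npoints V (A (ij, k)) @^-1` U k).
Proof.
move=> uS.
(* Requiring nothing ([setT]) of the sectors outside [S] lets the full family yield the product
   formula for a subfamily. *)
have := pr_npoints_fin PV (fun x => if x.1 \in S then U x.2 else setT) mA tA.
rewrite (_ : [set w | _] = [set w | forall ij, ij \in S -> counts_event ij w]); last first.
  apply/seteqP; split=> w /= H.
    by move=> ij ijS k; have := H (ij, k); rewrite /= ijS.
  by move=> [ij k] /=; case: ifP => // ijS; exact: H.
move=> ->; transitivity (\prod_ij \prod_k
    pr P (npoints V (A (ij, k)) @^-1` (if ij \in S then U k else setT))).
  by rewrite pair_bigA /=; apply: eq_bigr => -[ij k] _.
rewrite (bigID (mem S)) /= [X in _ * X]big1 ?mulr1; last first.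
  by move=> ij /negbTE ->; apply: big1 => k _; rewrite preimage_setT pr_setT.
rewrite big_uniq //=; apply: eq_bigr => ij ijS; apply: eq_bigr => k _.
by rewrite ijS.
Qed.

Lemma pr_counts_event ij :
  pr P (counts_event ij) = \prod_k pr P (npoints V (A (ij, k)) @^-1` U k).
Proof.
have := @pr_counts_events [:: ij] isT; rewrite big_seq1 => <-; congr pr.
apply/seteqP; split=> w /= H; first by move=> x; rewrite inE => /eqP ->.
by apply: H; rewrite inE.
Qed.

(** Independence is used inside a group, a union bound across groups. *)
Lemma pr_empty_group_le (q : R) : q <= 1 ->
  (forall ij, q <= \prod_k pr P (npoints V (A (ij, k)) @^-1` U k)) ->
  pr P [set w | exists i, forall j, ~ counts_event (i, j) w] <=
  #|I|%:R * (1 - q) ^+ #|J|.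
Proof.
move=> q1 qle.
have mE := measurable_counts_event.
have indep S : uniq S -> pr P [set w | forall ij, ij \in S -> counts_event ij w] =
    \prod_(ij <- S) pr P (counts_event ij).
  move=> uS; rewrite pr_counts_events //.
  by apply: eq_bigr => ij _; rewrite pr_counts_event.
apply: pr_exists => i.
  by apply: measurable_forall => j; exact: measurableC.
rewrite -/[set w | forall j, ~ counts_event (i, j) w].
pose S := [seq (i, j) | j <- enum J].
have uS : uniq S by rewrite map_inj_uniq ?enum_uniq // => j j' [].
rewrite cardE -(size_map (pair i)) -/S.
have -> : [set w | forall j, ~ counts_event (i, j) w] =
    [set w | forall ij, ij \in S -> ~ counts_event ij w].
  apply/seteqP; split=> w /= H; first by move=> ij /mapP[j _ ->]; exact: H.
  by move=> j; apply: H; apply: map_f; rewrite mem_enum.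
by apply: (pr_none_le mE indep uS q1) => ij; rewrite pr_counts_event.
Qed.

End GroupedEvents.

Section StarProbability.
Context {d : measure_display} {R : realType} {Om : measurableType d}.
Variables (P : probability Om R) (nu : R) (n : nat) (V : Om -> {fset R * R}).
Hypothesis nu_gt0 : 0 < nu.
Hypothesis PV : poisson_process (T := plane R) P (intensity_measure 1 nu n) V.
Local Notation rad := (hrg_radius nu n).
Local Notation mu := (intensity_measure 1 nu n).
Variables (h th : R) (K : nat).
Hypothesis rad_ge : 200 <= rad.
Hypothesis h_ge : 4 <= h.
Hypothesis h_le : h <= rad / 256.
Hypothesis th12 : 1 <= th <= 2.
Hypothesis K_le : K%:R <= nu / 64 * expR (h - 3).
Hypothesis K_large : 1 <= nu / 64 * expR (h - 3).

Let rad_ge2 : 2 <= rad.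
Proof. by apply: le_trans rad_ge; rewrite ler_nat. Qed.

Lemma measurable_star_region k : measurable (star_region rad h th k).
Proof.
case: k => [[|[|[|//]]] ?] /=.
- exact: measurable_hub.
- exact: measurable_leaves.
- exact: measurable_moat.
Qed.

(** The three factors are of different kinds: finding a hub point costs e^(-h), having enough leaves
    costs only 1/2, and an empty moat costs the exponential of its expected count. *)
Lemma pr_star_ge :
  nu / (32 * (1 + nu)) * expR (- h - 32 * nu * (expR (- (2 * h)) * rad + 6 * h)) <=
  \prod_k pr P (npoints (T := plane R) V (star_region rad h th k) @^-1` star_counts K k).
Proof.
have nu0 := nu_gt0; have h0 := h_ge.
rewrite 3!big_ord_recl big_ord0 mulr1 /star_region /star_counts /=.
have mh := measurable_hub rad h th; have ml := measurable_leaves rad h th.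
have mm := measurable_moat rad h th.
have hubge : nu / (16 * (1 + nu)) * expR (- h) <=
    pr P (npoints (T := plane R) V (hub rad h th) @^-1` (~` [set 0%N])).
  rewrite -preimage_setC pr_setC; last exact: (measurable_npoints PV).
  rewrite (pr_npoints_eq0 PV) //; last exact: intensity_measure_ge0.
  have le := hub_measure_ge nu_gt0 rad_ge h_ge h_le th12.
  set l := fine _ in le *.
  set l0 := nu / 16 * expR (- h) in le.
  have l00 : 0 < l0 by rewrite mulr_gt0 ?expR_gt0 // divr_gt0.
  have l0nu : l0 <= nu.
    rewrite /l0; have : expR (- h) <= 1 by rewrite -[leRHS]expR0 ler_expR; lra.
    have := expR_gt0 (- h); nra.
  (* Hence 1 - e^(-l) >= l0 / (1 + l0), and l0 <= nu turns this into a fixed multiple of l0. *)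
  have : expR (- l) <= (1 + l0)^-1.
    rewrite expRN lef_pV2 ?posrE ?expR_gt0 //; last lra.
    by have := expR_ge1Dx l; lra.
  have : (1 + l0)^-1 <= 1 - l0 / (1 + nu).
    rewrite -subr_ge0 (_ : _ - _ = l0 * (nu - l0) / ((1 + nu) * (1 + l0))); last first.
      by field; rewrite !gt_eqF //; lra.
    by rewrite divr_ge0 // mulr_ge0 //; lra.
  rewrite (_ : nu / (16 * (1 + nu)) * expR (- h) = l0 / (1 + nu)); first lra.
  by rewrite /l0; field; rewrite gt_eqF //; lra.
have leafge : 2^-1 <=
    pr P (npoints (T := plane R) V (leaves rad h th) @^-1` (~` [set m | (m < K)%N])).
  rewrite -preimage_setC pr_setC; last exact: (measurable_npoints PV).
  have := pr_npoints_lt (PV) K ml (intensity_measure_ge0 nu_gt0 rad_ge2 _).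
  have le := leaves_measure_ge nu_gt0 rad_ge h_ge h_le th12.
  have k1 := K_le; have k2 := K_large.
  have e2 : expR (- 1) <= 2^-1 :> R.
    by rewrite expRN lef_pV2 ?posrE ?expR_gt0 //; have := expR_ge1Dx (1 : R); lra.
  have : expR (K%:R - fine (mu (leaves rad h th)) / 2) <= expR (- 1).
    by rewrite ler_expR; lra.
  lra.
have moatge : expR (- (32 * nu * (expR (- (2 * h)) * rad + 6 * h))) <=
    pr P (npoints (T := plane R) V (moat rad h th) @^-1` [set 0%N]).
  rewrite (pr_npoints_eq0 PV) //; last exact: intensity_measure_ge0.
  by rewrite ler_expR lerN2; exact: moat_measure_le.
rewrite expRD (_ : nu / (32 * (1 + nu)) * _ = nu / (16 * (1 + nu)) * expR (- h) *
  (2^-1 * expR (- (32 * nu * (expR (- (2 * h)) * rad + 6 * h))))); last first.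
  by field; rewrite gt_eqF //; lra.
have c0 : 0 <= nu / (16 * (1 + nu)) by rewrite divr_ge0 //; lra.
apply: ler_pM; [by rewrite mulr_ge0 ?expR_ge0|by rewrite mulr_ge0 ?expR_ge0|exact: hubge|].
by apply: ler_pM; rewrite ?expR_ge0.
Qed.

End StarProbability.

(** * The good event *)

Section GoodEvent.
Context {d : measure_display} {R : realType} {Om : measurableType d}.
Variables (P : probability Om R) (nu : R) (n : nat) (V : Om -> {fset R * R}).
Hypothesis nu_gt0 : 0 < nu.
Hypothesis PV : PoissonHRG P 1 nu n V.
Local Notation rad := (hrg_radius nu n).
Local Notation mu := (intensity_measure 1 nu n).
Variables (h : R) (M K : nat).
Hypothesis rad_ge : 200 <= rad.
Hypothesis h_ge : 4 <= h.
Hypothesis h_le : h <= rad / 256.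
Hypothesis M_le : M%:R <= expR (rad / 64).

Let rad_ge2 : 2 <= rad.
Proof. by apply: le_trans rad_ge; rewrite ler_nat. Qed.

(** The pair is read as a two-digit number in base [M]. Since M^2 <= e^(rad/32), all centres fit
    into [1, 2] at spacing e^(-rad/32). *)
Definition sector_center (gj : 'I_M * 'I_M) : R :=
  1 + (gj.1 * M + gj.2)%:R * expR (- (rad / 32)).

Definition sector_region (x : 'I_M * 'I_M * 'I_3) : set (plane R) :=
  star_region rad h (sector_center x.1) x.2.

Definition core : set (plane R) := [set p | p.1 < rad / 4].

Definition good_event : set Om :=
  (npoints (T := plane R) V core @^-1` [set 0%N]) `&`
  [set w | forall g, exists j,
    counts_event (T := plane R) V sector_region (star_counts K) (g, j) w].

Lemma sector_center_bounds gj : 1 <= sector_center gj <= 2.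
Proof.
rewrite /sector_center; set w := expR _; set N := (_ + _)%N.
have w0 : 0 < w by exact: expR_gt0.
have N0 : 0 <= N%:R :> R by exact: ler0n.
have NM : N%:R <= expR (rad / 64) * expR (rad / 64).
  apply: (@le_trans _ _ (M%:R * M%:R)).
    rewrite -natrM ler_nat /N; case: gj @N {N0} => g j /=.
    apply: (@leq_trans (g.+1 * M)%N); last by rewrite leq_mul2r ltn_ord orbT.
    by rewrite mulSn addnC leq_add2r ltnW.
  by rewrite ler_pM.
have : expR (rad / 64) * expR (rad / 64) * w = 1.
  by rewrite /w -!expRD -expR0; congr expR; lra.
nra.
Qed.

Lemma sector_center_spread gj gj' : gj != gj' ->
  expR (- (rad / 32)) <= `|sector_center gj - sector_center gj'|.
Proof.
move=> ne; rewrite /sector_center opprD addrACA subrr add0r -mulrBl normrM.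
rewrite [X in _ <= _ * X]gtr0_norm ?expR_gt0 // ler_peMl ?expR_ge0 //.
have neN : (gj.1 * M + gj.2 != gj'.1 * M + gj'.2)%N.
  apply: contra ne => /eqP E; case: gj gj' E => [g j] [g' j'] /= E.
  have M0 : (0 < M)%N by apply: leq_ltn_trans (ltn_ord g).
  have Eg : g = g' :> nat.
    by have := congr1 (divn^~ M) E; rewrite /= !divnMDl // !divn_small ?addn0.
  have Ej : j = j' :> nat by move: E; rewrite Eg => /addnI.
  by rewrite (val_inj Eg) (val_inj Ej).
have wlog_lt (x y : nat) : (x < y)%N -> 1 <= `|x%:R - y%:R : R|.
  move=> xy; rewrite distrC ger0_norm ?subr_ge0 ?ler_nat ?(ltnW xy) //.
  by rewrite lerBrDr nat1r ler_nat.
by move: neN; rewrite neq_ltn => /orP[/wlog_lt//|/wlog_lt]; rewrite distrC.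
Qed.

Lemma star_region_angle th k p : star_region rad h th k p ->
  `|p.2 - th| < expR (- (rad / 32)) / 2.
Proof.
case: k => [[|[|[|//]]] ?] /=.
- by move=> [_]; exact: star_angle.
- by move=> [_]; exact: star_angle.
- exact: moat_angle.
Qed.

Lemma star_region_disjoint th k k' p :
  star_region rad h th k p -> star_region rad h th k' p -> k = k'.
Proof.
case: k k' => [[|[|[|//]]] i] [[|[|[|//]]] i'] /= a b; apply: val_inj => //=.
- by case: (hub_leaves_disjoint h_ge a b).
- by case: (hub_moat_disjoint h_ge a b).
- by case: (hub_leaves_disjoint h_ge b a).
- by case: (leaves_moat_disjoint h_ge a b).
- by case: (hub_moat_disjoint h_ge b a).
- by case: (leaves_moat_disjoint h_ge b a).
Qed.

Lemma close_center_eq gj gj' (x : R) :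
  `|x - sector_center gj| < expR (- (rad / 32)) / 2 ->
  `|x - sector_center gj'| < expR (- (rad / 32)) / 2 -> gj = gj'.
Proof.
move=> a b; apply/eqP/negPn/negP => /sector_center_spread.
have -> : sector_center gj - sector_center gj' =
  (x - sector_center gj') - (x - sector_center gj) by lra.
by move=> /le_trans/(_ (ler_normB _ _)); lra.
Qed.

Lemma trivIset_sector_region : trivIset [set: 'I_M * 'I_M * 'I_3] sector_region.
Proof.
move=> [gj k] [gj' k'] _ _ [p [/= a b]].
have E : gj = gj' := close_center_eq (star_region_angle a) (star_region_angle b).
by move: a b; rewrite /sector_region /= E => a b; rewrite (star_region_disjoint a b).
Qed.

Lemma measurable_sector_region x : measurable (sector_region x).
Proof. exact: measurable_star_region. Qed.

Lemma measurable_core : measurable core.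
Proof.
rewrite (_ : core = `]-oo, rad / 4[%classic `*` setT :> set (plane R)).
  by apply: measurableX => //; exact: measurable_itv.
by apply/seteqP; split=> p /=; rewrite /core /= in_itv //=; case.
Qed.

Lemma measurable_good_event : measurable good_event.
Proof.
apply: measurableI; first exact: (measurable_npoints PV.2 _ measurable_core).
apply: measurable_forall => g; apply: measurable_exists => j.
by apply: (measurable_counts_event PV.2) => x; exact: measurable_sector_region.
Qed.

Lemma npoints_eq0 (A : set (plane R)) w p :
  npoints (T := plane R) V A w = 0%N -> p \in V w -> ~ A p.
Proof.
move=> /eqP; rewrite /npoints cardfs_eq0 => /eqP H pV Ap.
have : p \in [fset x in V w | x \in A]%fset by rewrite !inE /= pV mem_set.
by rewrite H inE.
Qed.

Lemma npoints_neq0 (A : set (plane R)) w :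
  npoints (T := plane R) V A w <> 0%N -> exists v : V w, A (val v).
Proof.
move=> /eqP; rewrite /npoints cardfs_eq0 => /fset0Pn[p].
rewrite !inE /= => /andP[pV /set_mem Ap].
by exists [` pV]%fset.
Qed.

(** One successful sector is chosen in each group, and a hub point represents its component.
    Emptiness of the core and of the moat feeds [no_crossing], so no edge leaves the sector; the
    leaves give the size. *)
Lemma good_event_components w : good_event w ->
  (M <= #|[set C in components rad (V w) | (K <= #|C|)%N]%SET|)%N.
Proof.
move=> [/= core0 groups].
have [j jP] : {j : 'I_M -> 'I_M & forall g, counts_event (T := plane R) V
    sector_region (star_counts K) (g, j g) w}.
  exists (fun g => projT1 (cid (groups g))) => g.
  exact: (projT2 (cid (groups g))).
have hubP g : exists v : V w, hub rad h (sector_center (g, j g)) (val v).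
  by apply: npoints_neq0; exact: (jP g (@Ordinal 3 0 isT)).
have leafP g : (K <= npoints (T := plane R) V (leaves rad h (sector_center (g, j g))) w)%N.
  by rewrite leqNgt; apply/negP; exact: (jP g (@Ordinal 3 1 isT)).
have moatP g : npoints (T := plane R) V (moat rad h (sector_center (g, j g))) w = 0%N.
  exact: (jP g (@Ordinal 3 2 isT)).
pose c g := projT1 (cid (hubP g)).
have cP g : hub rad h (sector_center (g, j g)) (val (c g)).
  exact: (projT2 (cid (hubP g))).
rewrite -[X in (X <= _)%N]card_ord.
apply: (leq_card_components (c := c)
  (S := fun g => sector rad h (sector_center (g, j g)))).
- by move=> g; apply: hub_sector; [exact: h_ge|exact: cP].
- move=> g g' _ _ [p [a b]].
  by case: (close_center_eq (sector_angle rad_ge h_ge h_le a)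
    (sector_angle rad_ge h_ge h_le b)).
- move=> g u v su /andP[_ uv]; apply: contrapT => sv.
  have core_ge (x : V w) : rad / 4 <= (val x).1.
    by rewrite leNgt; apply/negP; apply: (npoints_eq0 core0 (valP x)).
  have := no_crossing rad_ge h_ge h_le (sector_center_bounds _) (core_ge u) (core_ge v)
    (PV.1 _ _ (valP u)) (PV.1 _ _ (valP v)) su (npoints_eq0 (moatP g) (valP u)) sv
    (npoints_eq0 (moatP g) (valP v)).
  by rewrite ltNge uv.
- move=> g; apply: leq_trans (leafP g) _.
  rewrite (npoints_card _ (erefl (V w))); apply: subset_leq_card.
  apply/fintype.subsetP => v; rewrite !inE /= => lv; apply/andP; split.
    apply/eqP => cv; move: lv; rewrite -cv => lv.
    exact: (hub_leaves_disjoint h_ge (cP g) lv).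
  exact: hub_leaves_adjacent (cP g) lv.
Qed.

Lemma pr_good_event_ge (q : R) : q <= 1 ->
  (forall gj, q <= \prod_k pr P (npoints (T := plane R) V
     (star_region rad h (sector_center gj) k) @^-1` star_counts K k)) ->
  1 - 2 * nu * rad * expR (- (rad / 4)) - M%:R * (1 - q) ^+ M <= pr P good_event.
Proof.
move=> q1 qle.
have mg := measurable_good_event.
have mc := measurable_npoints PV.2 [set 0%N] measurable_core.
have mE gj := measurable_counts_event PV.2 (star_counts K) measurable_sector_region gj.
pose empty_group : set Om := [set w | exists g, forall j,
  ~ counts_event (T := plane R) V sector_region (star_counts K) (g, j) w].
have me : measurable empty_group.
  apply: measurable_exists => g; apply: measurable_forall => j.
  by apply: measurableC; exact: mE.
have := pr_empty_group_le PV.2 measurable_sector_region trivIset_sector_region q1 qle.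
rewrite -/empty_group !card_ord => He.
have Hc : pr P (~` (npoints (T := plane R) V core @^-1` [set 0%N])) <=
    2 * nu * rad * expR (- (rad / 4)).
  rewrite pr_setC // (pr_npoints_eq0 PV.2 measurable_core); last first.
    exact: (intensity_measure_ge0 nu_gt0 rad_ge2).
  have := core_measure_le nu_gt0 rad_ge; rewrite -/core => Hcore.
  by have := expR_ge1Dx (- fine (mu core)); lra.
have : pr P (~` good_event) <=
    pr P (~` (npoints (T := plane R) V core @^-1` [set 0%N]) `|` empty_group).
  apply: pr_le; [exact: measurableC|apply: measurableU => //; exact: measurableC|].
  move=> w /= ngood; apply: contrapT => /not_orP[/contrapT c0 ne].
  apply: ngood; split => // g; apply: contrapT => nj.
  by apply: ne; exists g => j Ej; apply: nj; exists j.
rewrite pr_setC //.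
have := pr_setU P (measurableC mc) me; lra.
Qed.

End GoodEvent.

(** * Asymptotics *)

Section Asymptotics.
Context {R : realType}.
Implicit Types (nu a r q : R).

(** With X = e^(r/128), a group has about X^2 sectors and success probability at least 1/X, so it
    fails with probability at most e^(-X/2). The cubic Taylor term, X^3 / 48, beats the X^2 groups
    by a factor of order X. *)
Lemma empty_groups_bound r q (M : nat) :
  expR (- (r / 128)) <= q -> q <= 1 ->
  expR (r / 64) / 2 <= M%:R -> M%:R <= expR (r / 64) ->
  M%:R * (1 - q) ^+ M <= 48 * expR (- (r / 128)).
Proof.
move=> q0 q1 M1 M2.
set X := expR (r / 128); have X0 : 0 < X by exact: expR_gt0.
have XX : expR (r / 64) = X ^+ 2 by rewrite expr2 -expRD; congr expR; lra.
rewrite XX in M1 M2.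
have qM : X / 2 <= q * M%:R.
  have : expR (- (r / 128)) * (X ^+ 2 / 2) <= q * M%:R.
    by rewrite ler_pM ?expR_ge0 // divr_ge0 // sqr_ge0.
  rewrite expRN -/X (_ : X^-1 * _ = X / 2) //; first by field; rewrite gt_eqF.
have pow : (1 - q) ^+ M <= expR (- (X / 2)).
  apply: (@le_trans _ _ (expR (- q) ^+ M)).
    rewrite lerXn2r ?nnegrE ?expR_ge0 ?subr_ge0 //.
    exact: expR_ge1Dx.
  by rewrite -expRM_natl ler_expR; lra.
have cube : expR (- (X / 2)) <= 48 / X ^+ 3.
  rewrite expRN -[48 / _]invrK lef_pV2 ?posrE ?expR_gt0 ?invr_gt0 ?divr_gt0 ?exprn_gt0 //.
  have := @expR_ge1Dxn R (X / 2) 2; rewrite divr_ge0 ?(ltW X0) // => /(_ isT).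
  apply: le_trans.
  rewrite (_ : (48 / X ^+ 3)^-1 = (X / 2) ^+ 3 / (3`!)%:R) ?lerDr //.
  by rewrite (_ : 3`! = 6%N) //; field; rewrite gt_eqF.
apply: (@le_trans _ _ (X ^+ 2 * (48 / X ^+ 3))).
  apply: ler_pM => //; last exact: le_trans cube.
  by rewrite exprn_ge0 // subr_ge0.
rewrite expRN -/X le_eqVlt; apply/orP; left; apply/eqP; field.
by rewrite gt_eqF.
Qed.

Lemma core_bound nu r : 0 < nu -> 0 <= r ->
  2 * nu * r * expR (- (r / 4)) <= 16 * nu * expR (- (r / 128)).
Proof.
move=> nu0 r0.
have h : r <= 8 * expR (r / 8) by have := expR_ge1Dx (r / 8); lra.
have e1 : expR (r / 8) * expR (- (r / 4)) <= expR (- (r / 128)).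
  by rewrite -expRD ler_expR; lra.
have e2 := expR_gt0 (- (r / 4)).
have : r * expR (- (r / 4)) <= 8 * expR (- (r / 128)) by nra.
nra.
Qed.

(** Of the exponent r / 128, one half pays exactly for h + 192 nu h. The other half absorbs the
    constants, among them the moat term 32 nu r e^(-2h) <= 64 nu / a, which is bounded because r is
    a multiple of h. *)
Lemma star_bound nu a r (h := a * r / 4) : 0 < nu -> 0 < a -> a * (1 + 192 * nu) = 1 / 64 ->
  0 < r -> 32 * (1 + nu) / nu * expR (64 * nu / a) <= expR (r / 256) ->
  expR (- (r / 128)) <=
    nu / (32 * (1 + nu)) * expR (- h - 32 * nu * (expR (- (2 * h)) * r + 6 * h)).
Proof.
move=> nu0 a0 aE r0 C.
have hr : h * (1 + 192 * nu) = r / 256.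
  have : a * (1 + 192 * nu) * r = 1 / 64 * r by rewrite aE.
  rewrite /h; lra.
have h0 : 0 < h by rewrite /h !mulr_gt0.
have small : expR (- (2 * h)) * r <= 2 / a.
  have h2 : 2 * h <= expR (2 * h) by have := expR_ge1Dx (2 * h); lra.
  rewrite expRN mulrC ler_pdivrMr ?expR_gt0 //.
  rewrite (_ : r = 2 / a * (2 * h)); last by rewrite /h; field; rewrite gt_eqF.
  by rewrite ler_wpM2l // divr_ge0 // ltW.
have c0 : 0 < nu / (32 * (1 + nu)) by rewrite divr_gt0 //; lra.
have : nu / (32 * (1 + nu)) * expR (- (64 * nu / a) - r / 256) <=
    nu / (32 * (1 + nu)) * expR (- h - 32 * nu * (expR (- (2 * h)) * r + 6 * h)).
  rewrite ler_wpM2l ?(ltW c0) // ler_expR.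
  have : 32 * nu * (expR (- (2 * h)) * r) <= 32 * nu * (2 / a) by rewrite ler_wpM2l //; lra.
  lra.
apply: le_trans.
have C' : expR (- (r / 256)) <= nu / (32 * (1 + nu)) * expR (- (64 * nu / a)).
  rewrite !expRN -[nu / _]invf_div -invfM lef_pV2 ?posrE ?expR_gt0 //.
  by rewrite mulr_gt0 ?expR_gt0 // divr_gt0 //; lra.
rewrite expRD mulrA (_ : - (r / 128) = - (r / 256) + - (r / 256)); last lra.
by rewrite expRD ler_wpM2r ?expR_ge0.
Qed.

Lemma star_bound_le1 nu h r : 0 < nu -> 0 <= h -> 0 <= r ->
  nu / (32 * (1 + nu)) * expR (- h - 32 * nu * (expR (- (2 * h)) * r + 6 * h)) <= 1.
Proof.
move=> nu0 h0 r0; rewrite -[leRHS]mulr1; apply: ler_pM; rewrite ?expR_ge0 //.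
- by rewrite divr_ge0 //; lra.
- by rewrite ler_pdivrMr; lra.
- have : 0 <= expR (- (2 * h)) * r by rewrite mulr_ge0 ?expR_ge0.
  have nu1 : 0 <= 32 * nu by lra.
  move=> e0; rewrite -[leRHS]expR0 ler_expR.
  have : 0 <= 32 * nu * (expR (- (2 * h)) * r + 6 * h) by rewrite mulr_ge0 //; lra.
  lra.
Qed.

Lemma near_hrg_radius_ge nu (b : R) : 0 < nu ->
  \forall n \near \oo, b <= hrg_radius nu n.
Proof.
move=> nu0; near=> n; rewrite /hrg_radius.
have n0 : nu * expR (b / 2) <= n%:R by near: n; exact: nbhs_infty_ger.
have e0 := expR_gt0 (b / 2).
have ble : expR (b / 2) <= n%:R / nu by rewrite ler_pdivlMr // mulrC.
have : b / 2 <= ln (n%:R / nu).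
  by rewrite -[leLHS]expRK ler_ln ?posrE // (lt_le_trans e0 ble).
lra.
Unshelve. all: by end_near. Qed.

(** The lower bound on the radius rules out n = 0, where [ln 0] is 0 by convention and so is the
    radius. *)
Lemma expR_hrg_radius nu (b : R) n : 0 < nu -> 200 <= hrg_radius nu n ->
  expR (b * hrg_radius nu n) = n%:R `^ (2 * b) * expR (- (2 * b * ln nu)).
Proof.
move=> nu0 r0; have n0 : 0 < n%:R :> R.
  rewrite ltr0n lt0n; apply/eqP => n0; move: r0.
  by rewrite n0 /hrg_radius mul0r ln0 // mulr0 leNgt ltr0n.
rewrite /powR gt_eqF // -expRD /hrg_radius ln_div ?posrE //.
by congr expR; ring.
Qed.

Lemma aas_sub (alpha nu : R) (Q Q' : nat -> {fset (R * R)} -> Prop) :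
  (forall n V, Q n V -> Q' n V) -> aas alpha nu Q -> aas alpha nu Q'.
Proof.
move=> QQ' H d Om P V PV; have [E [mE EQ cvgE]] := H d Om P V PV.
by exists E; split => // n w /EQ /= Qw; exact: QQ'.
Qed.

(** The deterministic outcome from which both claims of the theorem follow, so that the
    probabilistic work is done once. *)
Definition many_stars (a nu : R) (n : nat) (V : {fset (R * R)}) : Prop :=
  let r := hrg_radius nu n in
  exists M K : nat, [/\ (1 < M)%N, expR (r / 64) / 2 <= M%:R,
    nu / 128 * expR (a * r / 4 - 3) <= K%:R, 200 <= r &
    (M <= #|[set C in components r V | (K <= #|C|)%N]%SET|)%N].

Lemma truncn_half (x : R) : 1 <= x -> x / 2 <= (Num.truncn x)%:R <= x.
Proof.
move=> x1; have x0 : 0 <= x by lra.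
have /andP[a b] := truncn_itv x0; rewrite a andbT.
have : (1 <= Num.truncn x)%N by rewrite truncn_gt0.
by rewrite -(ler_nat R); move: b; rewrite -nat1r; lra.
Qed.

(* Makes the exponent h + 192 nu h of star_bound equal to r / 256, where
   h = a r / 4. *)
Definition star_exponent nu : R := 1 / (64 * (1 + 192 * nu)).

Lemma star_exponent_gt0 nu : 0 < nu -> 0 < star_exponent nu.
Proof. by move=> nu0; rewrite divr_gt0 //; lra. Qed.

Lemma star_exponentE nu : 0 < nu -> star_exponent nu * (1 + 192 * nu) = 1 / 64.
Proof. by move=> nu0; rewrite /star_exponent; field; rewrite gt_eqF //; lra. Qed.

Lemma star_exponent_le nu : 0 < nu -> star_exponent nu <= 1 / 64.
Proof.
move=> nu0; have := star_exponent_gt0 nu0; have := star_exponentE nu0.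
move: (star_exponent nu) => a; nra.
Qed.

Lemma radius_threshold nu a (C : R) : 0 < nu -> 0 < a -> a <= 1 / 64 -> 0 < C ->
  exists r0, forall r, r0 <= r -> [/\ 200 <= r, 4 <= a * r / 4,
    a * r / 4 <= r / 256, 1 <= nu / 64 * expR (a * r / 4 - 3) &
    C <= expR (r / 256)].
Proof.
move=> nu0 a0 a64 C0.
have i1 : 0 < 16 / a by rewrite divr_gt0.
have i0 : 0 < 64 / nu by rewrite divr_gt0.
have i2 : 0 < 4 * (3 + 64 / nu) / a by rewrite divr_gt0 // mulr_gt0 //; lra.
exists (200 + 16 / a + 4 * (3 + 64 / nu) / a + 256 * C) => r rr.
have r200 : 200 <= r by lra.
have h16 : 16 <= a * r by rewrite (mulrC a) -ler_pdivrMr //; lra.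
have h3 : 4 * (3 + 64 / nu) <= a * r by rewrite (mulrC a) -ler_pdivrMr //; lra.
split => //.
- by lra.
- by nra.
- have : 64 / nu <= expR (a * r / 4 - 3).
    by have := expR_ge1Dx (a * r / 4 - 3); lra.
  by rewrite ler_pdivrMr //; lra.
- by have := expR_ge1Dx (r / 256); lra.
Qed.

Lemma pr_good_event_tends {d} {Om : measurableType d} (P : probability Om R)
    nu a n (V : Om -> {fset R * R}) (K M : nat) (r := hrg_radius nu n) (h := a * r / 4) :
  0 < nu -> 0 < a -> a * (1 + 192 * nu) = 1 / 64 ->
  200 <= r -> 4 <= h -> h <= r / 256 -> 1 <= nu / 64 * expR (h - 3) ->
  32 * (1 + nu) / nu * expR (64 * nu / a) <= expR (r / 256) ->
  K%:R <= nu / 64 * expR (h - 3) ->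
  expR (r / 64) / 2 <= M%:R -> M%:R <= expR (r / 64) ->
  PoissonHRG P 1 nu n V ->
  1 - (16 * nu + 48) * expR (- (r / 128)) <= pr P (good_event nu n V h M K).
Proof.
move=> nu0 a0 aE c1 c2 c3 c4 c5 k2 m1 m2 PV.
have rpos : 0 < r by exact: lt_le_trans c1.
have h0 : 0 <= h by exact: le_trans c2.
have qlow := star_bound nu0 a0 aE rpos c5.
have q1 := star_bound_le1 nu0 h0 (ltW rpos).
have := pr_good_event_ge nu0 PV c1 c2 c3 q1
  (fun gj => pr_star_ge nu0 PV.2 c1 c2 c3 (sector_center_bounds m2 gj) k2 c4).
apply: le_trans; rewrite mulrDl opprD addrA.
apply: lerB (empty_groups_bound qlow q1 m1 m2); apply: lerB => //.
exact: core_bound nu0 (ltW rpos).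
Qed.

Lemma aas_many_stars nu : 0 < nu -> aas 1 nu (many_stars (star_exponent nu) nu).
Proof.
move=> nu0 d Om P V PV; have aE := star_exponentE nu0; have a64 := star_exponent_le nu0.
have a0 := star_exponent_gt0 nu0; move: (star_exponent nu) aE a64 a0 => a aE a64 a0.
have C0 : 0 < 32 * (1 + nu) / nu * expR (64 * nu / a).
  by rewrite mulr_gt0 ?expR_gt0 // divr_gt0 //; lra.
have [r0 thr] := radius_threshold nu0 a0 a64 C0.
pose M n := Num.truncn (expR (hrg_radius nu n / 64)).
pose K n := Num.truncn (nu / 64 * expR (a * hrg_radius nu n / 4 - 3)).
(* [aas] demands the inclusion for every n, so the event is empty as long as the radius is below the
   threshold; the limit does not notice. *)
pose E n : set (Om n) := if r0 <= hrg_radius nu n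
  then good_event nu n (V n) (a * hrg_radius nu n / 4) (M n) (K n) else set0.
have expR_ge (x : R) : 0 <= x -> 1 <= expR x.
  by move=> x0; rewrite -[leLHS]expR0 ler_expR.
have M12 n : r0 <= hrg_radius nu n ->
    expR (hrg_radius nu n / 64) / 2 <= (M n)%:R <= expR (hrg_radius nu n / 64).
  move=> /thr[r200 _ _ _ _]; apply: truncn_half; apply: expR_ge.
  by rewrite divr_ge0 // (le_trans _ r200).
have mE n : measurable (E n).
  by rewrite /E; case: ifP => // _; exact: (measurable_good_event (PV n)).
exists E; split => //.
- move=> n w; rewrite /E; case: ifP => // rn gw /=; have [c1 c2 c3 c4 c5] := thr _ rn.
  have /andP[m1 m2] := M12 n rn.
  have /andP[k1 _] := truncn_half c4.
  exists (M n), (K n); split => //.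
  + rewrite -(ltr_nat R); apply: lt_le_trans m1.
    by have := expR_ge1Dx (hrg_radius nu n / 64); lra.
  + by apply: le_trans k1; rewrite -mulrA -[leRHS]mulrA (mulrAC nu) mulrA; lra.
  + exact: (good_event_components (PV n) c1 c2 c3 m2 gw).
have lower n : r0 <= hrg_radius nu n ->
    1 - (16 * nu + 48) * expR (- (hrg_radius nu n / 128)) <= pr (P n) (E n).
  move=> rn; rewrite /E rn; have [c1 c2 c3 c4 c5] := thr _ rn.
  have /andP[m1 m2] := M12 n rn; have /andP[_ k2] := truncn_half c4.
  exact: pr_good_event_tends.
apply: cvg_EFin; first by near=> n; exact: fin_num_measure.
apply/cvgrPdist_le => e e0; near=> n.
have rn : r0 <= hrg_radius nu n by near: n; exact: near_hrg_radius_ge.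
rewrite -/(pr (P n) (E n)) ger0_norm; last by rewrite subr_ge0 pr_le1.
apply: (@le_trans _ _ ((16 * nu + 48) * expR (- (hrg_radius nu n / 128)))).
  by rewrite lerBlDr addrC -lerBlDr lower.
have big : 128 * ((16 * nu + 48) / e) <= hrg_radius nu n.
  by near: n; exact: near_hrg_radius_ge.
rewrite expRN ler_pdivrMr ?expR_gt0 // -ler_pdivrMl // mulrC.
apply: le_trans (expR_ge1Dx _); move: (hrg_radius nu n) big => r.
by clear; move: (_ / e) => x; lra.
Unshelve. all: by end_near. Qed.

End Asymptotics.

Theorem proposition3 (R : realType) (nu : R) (nu_gt0 : 0 < nu) :
  exists gamma : R, 0 < gamma < 1 /\
    (exists c1 : R, 0 < c1 /\
       aas 1 nu (fun n V =>
         c1 * n%:R `^ gamma <= (L2 (hrg_radius nu n) V)%:R)) /\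
    (exists delta : R, 0 < delta < gamma /\
       exists b : R, 0 < b /\
       exists c2 c3 : R, 0 < c2 /\ 0 < c3 /\
         aas 1 nu (fun n V =>
           c2 * n%:R `^ b <=
             (ncomponents_ge (hrg_radius nu n) V (c3 * n%:R `^ delta))%:R)).
Proof.
have a0 := star_exponent_gt0 nu_gt0; have := star_exponent_le nu_gt0.
set a := star_exponent nu in a0 * => a64.
(* The last factor is nu^(-a/2), from e^(a rad / 4) = (n / nu)^(a/2). *)
pose c := nu / 128 * expR (- 3) * expR (- (a / 2 * ln nu)).
have c0 : 0 < c by rewrite !mulr_gt0 ?expR_gt0 // divr_gt0.
have size_ge n (K : nat) : 200 <= hrg_radius nu n ->
    nu / 128 * expR (a * hrg_radius nu n / 4 - 3) <= K%:R -> c * n%:R `^ (a / 2) <= K%:R.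
  move=> r0; apply: le_trans.
  rewrite expRD (_ : a * _ / 4 = a / 4 * hrg_radius nu n); last by field.
  rewrite expR_hrg_radius // (_ : 2 * (a / 4) = a / 2); last by field.
  by rewrite /c le_eqVlt; apply/orP; left; apply/eqP; ring.
exists (a / 2); split; first lra; split.
  exists c; split => //; apply: aas_sub (aas_many_stars nu_gt0).
  move=> n V [M [K [M1 _ Kge r0 MC]]].
  apply: le_trans (size_ge _ _ r0 Kge) _; rewrite ler_nat; apply: leq_L2.
  exact: leq_trans MC.
(* The same components have size of order n^(a/2), so any positive exponent below a / 2 would serve.
   The next witness comes from M >= e^(rad/64) / 2, which is (n / nu)^(1/32) / 2. *)
exists (a / 4); split; first lra.
exists (1 / 32); split; first lra.
exists (expR (- (1 / 32 * ln nu)) / 2), c; split; first by rewrite divr_gt0 ?expR_gt0.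
split => //; apply: aas_sub (aas_many_stars nu_gt0).
move=> n V [M [K [M1 Mge Kge r0 MC]]].
apply: (@le_trans _ _ M%:R).
  apply: le_trans Mge.
  rewrite (_ : hrg_radius nu n / 64 = 1 / 64 * hrg_radius nu n); last by field.
  rewrite expR_hrg_radius // (_ : 2 * (1 / 64) = 1 / 32); last by field.
  by rewrite le_eqVlt; apply/orP; left; apply/eqP; field.
rewrite ler_nat; apply: leq_trans MC _; apply: subset_leq_card.
apply/fintype.subsetP => C; rewrite !inE => /andP[-> KC] /=.
have n1 : (0 < n)%N.
  rewrite lt0n; apply/eqP => n0; move: r0.
  by rewrite n0 /hrg_radius mul0r ln0 // mulr0 leNgt ltr0n.
apply: (@le_trans _ _ (c * n%:R `^ (a / 2))).
  by rewrite ler_wpM2l ?(ltW c0) // ler_powR ?ler1n //; lra.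
by apply: le_trans (size_ge _ _ r0 Kge) _; rewrite ler_nat.
Qed.
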